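(* (1) For every integer $q$ with $q=3k$ for some $k\ge 2$, or $q=3k+1$ for some $k\ge 3$, there exist infinitely many pairwise non-isomorphic cyclic $q$-equivelar triangulations of orientable closed surfaces, and infinitely many pairwise non-isomorphic cyclic $q$-equivelar triangulations of non-orientable closed surfaces. (2) Up to combinatorial isomorphism there are exactly two cyclic $7$-equivelar triangulations of closed surfaces. Both have $n=12$ vertices and triangulate the orientable surface of genus $2$; with vertex set $\mathbb{Z}_{12}$ they are generated by the triangles $[0,1,2],[0,2,6],[0,4,8]$ and by $[0,1,5],[0,1,6],[0,4,8]$, respectively.
   Context: For an integer $n\ge 3$ identify a vertex set with $\mathbb{Z}_n=\{0,1,\dots,n-1\}$; integers used as vertices are read modulo $n$. A triangle $[a,b,c]$ is a 3-element subset of $\mathbb{Z}_n$. Its orbit is $\{[a+i,b+i,c+i]: i\in\mathbb{Z}_n\}$. The complex generated by a list of triangles is the pure 2-dimensional simplicial complex whose triangles are the union of the orbits of the listed triangles. A cyclic triangulation with $n$ vertices is a simplicial complex on the vertex set $\mathbb{Z}_n$ that triangulates a closed (compact, connected, boundaryless) surface and is invariant under the shift $i\mapsto i+1$. Equivalently, it is a triangulated closed surface whose automorphism group contains a cyclic subgroup permuting all $n$ vertices in a single cycle. A triangulation is $q$-equivelar if every vertex lies in exactly $q$ triangles. *)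

(* Defs.v *)
From HB Require Import structures.
From mathcomp Require Import all_boot all_order all_algebra.
Set Implicit Arguments. Unset Strict Implicit. Unset Printing Implicit Defensive.

(* A pure 2-dimensional complex on the vertex set Z_n = 'I_n is a set of
   triangles (3-element subsets of 'I_n). *)
Definition complex (n : nat) := {set {set 'I_n}}.

Definition shift n (i : 'I_n) : 'I_n := ordS i.

Definition edges n (K : complex n) : {set {set 'I_n}} :=
  [set e : {set 'I_n} | (#|e| == 2) && [exists t in K, e \subset t]].

(* Combinatorial triangulated closed surface (combinatorial 2-manifold):
   all faces are triangles, every vertex of Z_n is used, every edge lies in
   exactly two triangles, the link of every vertex is a single cycle
   (connected; 2-regularity follows from the edge condition), and the complex
   is connected. *)
Definition closed_surface n (K : complex n) : Prop :=
  [/\ (forall t, t \in K -> #|t| = 3),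
      (forall v : 'I_n, exists2 t, t \in K & v \in t),
      (forall e, e \in edges K -> #|[set t in K | e \subset t]| = 2),
      (forall v a b : 'I_n,
          [set v; a] \in edges K -> [set v; b] \in edges K -> a != v -> b != v ->
          connect (fun x y => [set v; x; y] \in K) a b)
    & (forall u v : 'I_n,
          connect (fun x y => [exists t in K, (x \in t) && (y \in t)]) u v)].

Definition cyclic_triangulation n (K : complex n) : Prop :=
  [/\ 3 <= n, closed_surface K & forall t, t \in K -> @shift n @: t \in K].

Definition equivelar (q : nat) n (K : complex n) : Prop :=
  forall v : 'I_n, #|[set t in K | v \in t]| = q.

(* Orientability: a choice of cyclic ordering (a,b,c) of each triangle such
   that no directed edge is used by two distinct triangles (coherent
   orientation). *)
Definition dedges n (o : 'I_n * 'I_n * 'I_n) : seq ('I_n * 'I_n) :=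
  let: (a, b, c) := o in [:: (a, b); (b, c); (c, a)].

Definition orientable n (K : complex n) : Prop :=
  exists o : {set 'I_n} -> 'I_n * 'I_n * 'I_n,
    (forall t, t \in K -> [set (o t).1.1; (o t).1.2; (o t).2] = t) /\
    (forall t1 t2 d, t1 \in K -> t2 \in K -> t1 != t2 ->
        d \in dedges (o t1) -> d \notin dedges (o t2)).

Definition euler_char n (K : complex n) : int :=
  (n%:Z - (#|edges K|)%:Z + (#|K|)%:Z)%R.

Definition orientable_genus n (K : complex n) (g : nat) : Prop :=
  orientable K /\ euler_char K = (2%:Z - (2 * g)%:Z)%R.

Definition isomorphic n m (K1 : complex n) (K2 : complex m) : Prop :=
  exists f : 'I_n -> 'I_m, bijective f /\ [set f @: (t : {set _}) | t in K1] = K2.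

Definition vmod n (a : nat) : 'I_n.+1 := Ordinal (ltn_pmod a (ltn0Sn n)).

Definition generated n (l : seq (nat * nat * nat)) : complex n.+1 :=
  \bigcup_(x <- l)
    [set [set vmod n (x.1.1 + i); vmod n (x.1.2 + i); vmod n (x.2 + i)]
    | i : 'I_n.+1].

(* Main.v *)
Require Import Defs.
From HB Require Import structures.
From mathcomp Require Import all_boot all_order all_algebra.
From mathcomp Require Import zify ring.
Set Implicit Arguments. Unset Strict Implicit. Unset Printing Implicit Defensive.
Import GRing.Theory Num.Theory.
Local Open Scope ring_scope.

(* A shift-invariant complex on Z_n is determined by the link of 0, a graph on the
   set of differences: the orbit of {0, x, y} contributes the edges {x, y},
   {y - x, - x} and {- y, x - y}. The complex is a closed surface when this graph
   is a single cycle and 1 is one of the differences. An orientation compatible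
   with the shift (preserved or reversed by it) is a coherent direction of the
   link edges.

   (1) Replacing an orbit {0, a, c} by five orbits that involve two fresh
   differences subdivides three link edges: the degree grows by 12 and a coherent
   direction survives. Starting from complexes whose degrees cover the residues
   mod 12, given by data over Z x Z_L that specialise to infinitely many Z_n, this
   reaches all q. Non-orientability survives because an orbit {0, x, 2x}, with x
   of odd order, spans a Moebius band and is never touched.

   (2) For q = 7 the link of 0 has 14 directed edges, on which (x, y) |->
   (y - x, - x) has order 3, and 7 vertices, on which negation has order 2. The
   fixed points are h, with 3h = 0 and an edge {h, -h}, and m with 2m = 0.
   Following the 7-cycle from h leaves two configurations, each made of multiples
   of a single element of order 12, which generates Z_n. *)

(** A full orbit contributes 3 to the degree and the short orbit {0, h, -h}, of which there is at
    most one, contributes 1; this is why q is 0 or 1 modulo 3. A handle trades one full orbit for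
    five, whence the step 12 = 4 * 3. The obstacle to attaching handles inside Z_n is that fresh
    differences may coincide with old ones. In Z x Z_L the infinite factor always has room, and n is
    chosen afterwards, large enough that finitely many inequalities survive. The finite factor is
    kept because h, and the m that an odd degree forces, are torsion: their residues grow with n, so
    no fixed integers represent them. When the shift reverses orientations, the reversing
    translations are the odd ones; L is even so that parity makes sense on Z_n. Handles are attached
    only to a triangle whose differences all have trivial sign. In degree 7 both h and m are forced,
    and they leave no free parameter: some link vertex, up to sign, is a half of m + h, hence
    torsion itself. So the residue 7 modulo 12 only starts with degree 19. *)

Definition connected_on (T : eqType) (E : seq (T * T)) (N : seq T) :=
  forall P : pred T, (forall e, e \in E -> P e.1 = P e.2) ->
  {in N &, forall x y, P x = P y}.

(** The third condition makes every vertex of degree two, a loop counting twice. [connected_on]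
    quantifies over predicates constant along edges, so that no path has to be carried through a
    modification of the graph. Loops and double edges are excluded later, by [edge_mult]. *)
Definition link_on (T : zmodType) (E : seq (T * T)) (N : seq T) :=
  [/\ uniq N, 0 \notin N, perm_eq (unzip1 E ++ unzip2 E) (N ++ N)
    & connected_on E N].

Definition coherent (T : eqType) (E : seq (T * T)) (N : seq T) :=
  perm_eq (unzip1 E) N && perm_eq (unzip2 E) N.

Definition flip (T : Type) (b : bool) (e : T * T) := if b then (e.2, e.1) else e.

Ltac count_lia :=
  repeat match goal with |- context [nat_of_bool ?b] => move: (nat_of_bool b) => ? end;
  move: (count _ _) => ?; lia.

(** * Link edges of an orbit, and the handle construction *)

Section Corners.
Variables (G : comNzRingType) (sgn : G -> bool).

(* Link edges at 0 of the translates of {0, a, c} containing 0. When sgn x, the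
   translation by x reverses orientations and the edge is listed backwards, so
   that an orientation amounts to each link vertex being once a tail and once a
   head (coherent). *)
Definition corners (t : G * G) : seq (G * G) :=
  [:: t; flip (sgn t.1) (t.2 - t.1, - t.1); flip (sgn t.2) (- t.2, t.1 - t.2)].

(* hs lists the elements h with 3h = 0 of the short orbits {0, h, -h}. *)
Definition star (ts : seq (G * G)) (hs : seq G) : seq (G * G) :=
  flatten [seq corners t | t <- ts] ++ [seq (h, - h) | h <- hs].

(* These five triangles replace {0, a, c}: its link edges (a, c), (c - a, - a) and
   (- c, a - c) become paths with the same ends that run through the fresh
   vertices, so that a link cycle remains a cycle. *)
Definition handle (a c w v : G) : seq (G * G) :=
  [:: (w, c); (a, w); (a - w, v); (v, a - c); (w - c, a - c - v)].

(** Six pairs of opposite differences, namely those of the five triangles other than [a], [c],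
    [a - c] up to sign. Four more orbits of triangles against six more orbits of edges: the Euler
    characteristic drops by twice the number of vertices. *)
Definition fresh (a c w v : G) : seq G :=
  [:: w; - w; w - a; a - w; w - c; c - w; v; - v; c - a + v; a - c - v;
      v + w - a; a - w - v].

(** These 15 edges form three directed paths. The first is [a], [w], [c]. The second is [c - a],
    [c - a + v], [v + w - a], [w - a], [- a]. The third is [- c], [w - c], [a - c - v], [- v],
    [a - w - v], [c - w], [- w], [a - w], [v], [a - c]. Their 1 + 3 + 8 inner vertices are the 12
    fresh ones. *)
Definition handle_link (a c w v : G) : seq (G * G) :=
  [:: (w, c); (c - w, - w); (- c, w - c); (a, w); (w - a, - a); (- w, a - w);
      (a - w, v); (v + w - a, w - a); (- v, a - w - v);
      (v, a - c); (a - c - v, - v); (c - a, c - a + v);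
      (w - c, a - c - v); (a - w - v, c - w); (c - a + v, v + w - a)].

Hypothesis sgnD : forall x y, sgn (x + y) = sgn x (+) sgn y.

Let sgn0 : sgn 0 = false.
Proof. by have := sgnD 0 0; rewrite addr0; case: (sgn 0). Qed.

Let sgnN x : sgn (- x) = sgn x.
Proof. by have := sgnD x (- x); rewrite subrr sgn0; case: (sgn x); case: (sgn _). Qed.

Lemma handle_corners a c w v :
    sgn a = false -> sgn c = false -> sgn w = false -> sgn v = false ->
  flatten [seq corners t | t <- handle a c w v] =
  handle_link a c w v.
Proof.
move=> sa sc sw sv; rewrite /handle [map _ _]/= [flatten _]/=.
rewrite /corners /= !(sgnD, sgnN, sa, sc, sw, sv) /=.
do ![congr (_ :: _) | congr (_, _)]; ring.
Qed.

Section Step.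
Variables (a c w v : G) (ts : seq (G * G)) (hs : seq G) (N : seq G).
Hypotheses (sa : sgn a = false) (sc : sgn c = false).
Hypotheses (sw : sgn w = false) (sv : sgn v = false).

Let E := star ((a, c) :: ts) hs.
Let E' := star (handle a c w v ++ ts) hs.

Lemma star_handleE : E' = handle_link a c w v ++ star ts hs.
Proof. by rewrite /E' /star map_cat flatten_cat handle_corners // -catA. Qed.

Lemma star_markedE : E = [:: (a, c); (c - a, - a); (- c, a - c)] ++ star ts hs.
Proof. by rewrite /E /star /= sa sc. Qed.

(** Each inner vertex of the three directed paths is a tail once, and each path starts at the tail
    of the edge that it replaces. The same holds for heads. *)
Lemma handle_tails : perm_eq (unzip1 E') (fresh a c w v ++ unzip1 E).
Proof.
rewrite star_handleE star_markedE; apply/permP => P.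
rewrite count_cat /unzip1 !map_cat !count_cat /=; count_lia.
Qed.

Lemma handle_heads : perm_eq (unzip2 E') (fresh a c w v ++ unzip2 E).
Proof.
rewrite star_handleE star_markedE; apply/permP => P.
rewrite count_cat /unzip2 !map_cat !count_cat /=; count_lia.
Qed.

Lemma coherent_handle : coherent E N -> coherent E' (fresh a c w v ++ N).
Proof.
case/andP=> p1 p2; apply/andP; split.
  by rewrite (perm_trans handle_tails) // perm_cat2l.
by rewrite (perm_trans handle_heads) // perm_cat2l.
Qed.

(** A predicate constant along the three paths agrees at their ends, hence is constant along the
    replaced edges and on [N]; every fresh vertex lies on a path that meets [N]. *)
Lemma link_on_handle : uniq (fresh a c w v ++ N) -> 0 \notin fresh a c w v ->
  link_on E N -> link_on E' (fresh a c w v ++ N).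
Proof.
move=> uF F0 [uN N0 pE cE]; split=> //; first by rewrite mem_cat negb_or F0.
  rewrite (perm_trans (perm_cat handle_tails handle_heads)) //.
  rewrite perm_catACA perm_sym perm_catACA perm_cat2l perm_sym; exact: pE.
move=> P PE.
have VN x : x \in unzip1 E ++ unzip2 E -> x \in N by rewrite (perm_mem pE) mem_cat orbb.
have [aN nbN naN] : [/\ a \in N, a - c \in N & - a \in N].
  by split; apply: VN; rewrite star_markedE mem_cat /= !(inE, mem_cat) eqxx ?orbT.
have : all (fun e => P e.1 == P e.2) (handle_link a c w v ++ star ts hs).
  by apply/allP => e; rewrite -star_handleE => /PE ->.
rewrite all_cat => /andP[]; rewrite /handle_link [all _ _]/=.
do 15!case/andP=> /eqP ?; move=> _ /allP Pts.
have PN : {in N &, forall x y, P x = P y}.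
  apply: cE => e; rewrite star_markedE mem_cat => /orP[|/Pts/eqP//].
  by rewrite !inE => /or3P[] /eqP -> /=; congruence.
have nbE := PN _ _ nbN aN; have naE := PN _ _ naN aN.
have PF x : x \in fresh a c w v ++ N -> P x = P a.
  rewrite mem_cat => /orP[|xN]; last exact: PN.
  suff /allP H : all (fun x => P x == P a) (fresh a c w v) by move/H/eqP.
  rewrite /=; do ![apply/andP; split]; apply/eqP => //; congruence.
by move=> x y /PF-> /PF->.
Qed.

End Step.

Section Rotation.
Variables (ts : seq (G * G)) (hs : seq G).
Hypothesis hs3 : forall h, h \in hs -> h + h + h = 0 /\ sgn h = false.

(* Translating a triangle {0, x, y} so that x (resp. y) becomes 0; the link
   edge is traversed backwards when the translation reverses the orientation. *)
Lemma star_rot x y : (x, y) \in star ts hs ->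
  flip (sgn x) (y - x, - x) \in star ts hs /\
  flip (sgn y) (- y, x - y) \in star ts hs.
Proof.
rewrite mem_cat => /orP[|/mapP[h hh [-> ->]]]; last first.
  have [h3 sh] := hs3 hh; rewrite sgnN sh /= !mem_cat opprK.
  have -> : - h - h = h - (h + h + h) by ring.
  rewrite h3 subr0; have -> : h + h = - h + (h + h + h) by ring.
  by rewrite h3 addr0 map_f ?orbT.
case/flatten_mapP=> -[a c] ts_ac xy.
suff [h1 h2] : flip (sgn x) (y - x, - x) \in corners (a, c) /\
               flip (sgn y) (- y, x - y) \in corners (a, c).
  by split; rewrite mem_cat; apply/orP; left; apply/flatten_mapP; exists (a, c).
move: xy; rewrite /corners /= !inE.
have e1 : c - a + a = c by ring.
have e2 : - a + (a - c) = - c by ring.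
have e3 : a - c + c = a by ring.
have e4 : - c + (c - a) = - a by ring.
case/or3P=> /eqP[].
- by move=> -> ->; rewrite !eqxx ?orbT.
- case sa: (sgn a) => /= -[-> ->]; rewrite ?opprB ?opprK !(sgnD, sgnN, sa) ?e1 ?e2 /=.
    by rewrite addbT; case: (sgn c); rewrite /= !eqxx ?orbT.
  by rewrite addbF !eqxx !orbT.
- case sc: (sgn c) => /= -[-> ->]; rewrite ?opprB ?opprK !(sgnD, sgnN, sc) ?e3 ?e4 /=.
    by rewrite addbT; case: (sgn a); rewrite /= !eqxx ?orbT.
  by rewrite addbF; case: (sgn a); rewrite /= !eqxx ?orbT.
Qed.

End Rotation.

End Corners.

(** * Connected 2-regular graphs *)

Section TwoRegular.
Variables (T : eqType) (E : seq (T * T)) (N : seq T).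
Hypotheses (uN : uniq N) (pE : perm_eq (unzip1 E ++ unzip2 E) (N ++ N)).
Hypothesis cE : connected_on E N.

Lemma size_edges : size E = size N.
Proof. by have := perm_size pE; rewrite !size_cat !size_map !addnn => /double_inj. Qed.

Lemma edge_mem x y : (x, y) \in E -> x \in N /\ y \in N.
Proof.
move=> xyE; have H z : z \in unzip1 E ++ unzip2 E -> z \in N.
  by rewrite (perm_mem pE) mem_cat orbb.
split; apply: H; rewrite mem_cat; apply/orP; [left | right].
  exact: (map_f fst xyE).
exact: (map_f snd xyE).
Qed.

Lemma degree2 x : x \in N ->
  (count (fun e => e.1 == x) E + count (fun e => e.2 == x) E = 2)%N.
Proof.
move=> xN; have /permP/(_ (pred1 x)) := pE.
by rewrite !count_cat !count_map (count_uniq_mem x uN) xN.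
Qed.

(* A loop or a double edge of a 2-regular graph is a whole connected component. *)
Lemma edge_mult x y : (2 < size N)%N -> (x, y) \in E ->
  x != y /\ (count_mem (x, y) E + count_mem (y, x) E <= 1)%N.
Proof.
move=> N3 xyE; have [xN yN] := edge_mem xyE.
pose p e := (e == (x, y)) || (e == (y, x)).
pose f z (e : T * T) := ((e.1 == z) + (e.2 == z))%N.
have sumf z : \sum_(e <- E) f z e =
    (count (fun e => e.1 == z) E + count (fun e => e.2 == z) E)%N.
  rewrite /f big_split /= -!sum1_count; congr (_ + _)%N.
    by rewrite [RHS]big_mkcond; apply: eq_bigr => e _; case: eqP.
  by rewrite [RHS]big_mkcond; apply: eq_bigr => e _; case: eqP.
have comp : (forall e, e \in E -> ~~ p e -> [&& e.1 != x, e.2 != x, e.1 != y & e.2 != y]) -> False.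
  move=> H; have sub : {subset N <= [:: x; y]}.
    move=> z zN; suff : (z \in [:: x; y]) = (x \in [:: x; y]) by rewrite !inE eqxx.
    apply: (cE (P := fun z => z \in [:: x; y])) => // e eE.
    case pe: (p e).
      by case/orP: pe => /eqP -> /=; rewrite !inE !eqxx ?orbT.
    have /and4P[/negPf h1 /negPf h2 /negPf h3 /negPf h4] := H _ eE (negbT pe).
    by rewrite !inE h1 h2 h3 h4.
  by have := uniq_leq_size uN sub; rewrite /=; lia.
have split2 z : z \in N -> (\sum_(e <- E | p e) f z e + \sum_(e <- E | ~~ p e) f z e = 2)%N.
  by move=> zN; have := degree2 zN; rewrite -sumf (bigID p).
(* If the edges between [x] and [y] already use up the degree 2 of [z], no other edge meets [z]. *)
have zero z : (2 <= \sum_(e <- E | p e) f z e)%N -> z \in N ->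
    forall e, e \in E -> ~~ p e -> (e.1 != z) && (e.2 != z).
  move=> le2 zN e eE pe; have := split2 z zN.
  have -> : (\sum_(e <- E | ~~ p e) f z e = f z e + \sum_(e' <- rem e E | ~~ p e') f z e')%N.
    by rewrite (big_rem e eE) /= pe.
  move: le2; move: (bigop _ _ _) (bigop _ _ _) => s1 s2.
  by rewrite /f; case: (e.1 == z); case: (e.2 == z) => //=; lia.
have [exy|nxy] := eqVneq x y.
  case: comp; subst y => e eE pe.
  suff /andP[-> ->] : (e.1 != x) && (e.2 != x) by [].
  apply: zero => //; rewrite (big_rem _ xyE) /= {1}/p eqxx /= /f eqxx; lia.
split=> //; rewrite leqNgt; apply/negP => le2; apply: comp => e eE pe.
have cp z : z \in [:: x; y] -> (2 <= \sum_(e <- E | p e) f z e)%N.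
  move=> zxy; apply: (@leq_trans (\sum_(e <- E | p e) 1)).
    rewrite sum1_count; apply: (leq_trans le2).
    have -> : (count_mem (x, y) E + count_mem (y, x) E)%N =
       (count (predU (pred1 (x, y)) (pred1 (y, x))) E + count (predI (pred1 (x, y)) (pred1 (y, x))) E)%N.
      by rewrite count_predUI.
    rewrite [X in (_ + X)%N](@eq_count _ _ pred0) ?count_pred0 ?addn0.
      by rewrite (@eq_count _ _ p).
    move=> -[u v] /=; apply/negP => /andP[/eqP[-> ->]].
    by rewrite xpair_eqE (negPf nxy).
  apply: leq_sum => e' /orP[] /eqP -> /=; rewrite /f /=;
    by move: zxy; rewrite !inE => /orP[] /eqP ->; rewrite eqxx ?addn1 ?add1n.
have /andP[-> ->] := zero x (cp x (mem_head _ _)) xN e eE pe.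
by have /andP[-> ->] := zero y (cp y (mem_last x [:: y])) yN e eE pe.
Qed.

Definition adj x y := ((x, y) \in E) || ((y, x) \in E).

Definition nbrs x := [seq e.2 | e <- E & e.1 == x] ++ [seq e.1 | e <- E & e.2 == x].

Lemma mem_nbrs x y : (y \in nbrs x) = adj x y.
Proof.
rewrite mem_cat /adj; congr (_ || _); apply/mapP/idP.
- by case=> -[u v]; rewrite mem_filter /= => /andP[/eqP-> uv] ->.
- by move=> h; exists (x, y); rewrite // mem_filter eqxx.
- by case=> -[u v]; rewrite mem_filter /= => /andP[/eqP-> uv] ->.
- by move=> h; exists (y, x); rewrite // mem_filter eqxx.
Qed.

Lemma adjC x y : adj x y = adj y x.
Proof. by rewrite /adj orbC. Qed.

Lemma adj_mem x y : adj x y -> x \in N /\ y \in N.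
Proof. by case/orP=> /edge_mem[]. Qed.

Hypothesis N3 : (2 < size N)%N.

Lemma adj_neq x y : adj x y -> x != y.
Proof. by case/orP=> /(edge_mult N3)[] //; rewrite eq_sym. Qed.

Lemma uniq_edges : uniq E.
Proof.
apply: count_mem_uniq => -[x y].
have [xyE|/count_memPn //] := boolP ((x, y) \in E).
have [_] := edge_mult N3 xyE; move: xyE; rewrite -has_pred1 has_count; lia.
Qed.

Lemma edge_asym x y : (x, y) \in E -> (y, x) \notin E.
Proof.
move=> xyE; have [_] := edge_mult N3 xyE; rewrite -!has_pred1 !has_count in xyE *.
by lia.
Qed.

Lemma size_nbrs x : x \in N -> size (nbrs x) = 2%N.
Proof. by move=> xN; rewrite size_cat !size_map !size_filter degree2. Qed.

Lemma uniq_nbrs x : uniq (nbrs x).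
Proof.
rewrite cat_uniq !map_inj_in_uniq ?filter_uniq ?uniq_edges //=; last first.
- by move=> -[u v] [u' v']; rewrite !mem_filter /= => /andP[/eqP-> _] /andP[/eqP-> _] ->.
- by move=> -[u v] [u' v']; rewrite !mem_filter /= => /andP[/eqP-> _] /andP[/eqP-> _] ->.
rewrite andbT; apply/hasPn => y /mapP[[u v]]; rewrite mem_filter /= => /andP[/eqP-> ux] ->.
apply/negP => /mapP[[u' v']]; rewrite mem_filter /= => /andP[/eqP-> xv] e.
by move: (edge_asym ux); rewrite e xv.
Qed.

End TwoRegular.

(** * Three-element sets, and the complex spanned by a link *)

Section Set3.
Variable T : finType.
Implicit Types x y z u v w : T.

Lemma cards3 x y z : #|[set x; y; z]| = 3%N <-> [/\ x != y, x != z & y != z].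
Proof.
have -> : [set x; y; z] = [set:: [:: x; y; z]].
  by apply/setP => u; rewrite !inE orbA.
rewrite cardsE; split=> [/card_uniqP|[xy xz yz]].
  by rewrite /= !inE negb_or andbT => /andP[/andP[]].
by apply/card_uniqP; rewrite /= !inE negb_or xy xz yz.
Qed.

Lemma set3_rot x y z : [set x; y; z] = [set y; z; x].
Proof. by apply/setP => u; rewrite !inE -orbA orbC. Qed.

Lemma set3_swap x y z : [set x; y; z] = [set x; z; y].
Proof. by rewrite setUAC. Qed.

Lemma set3_inj a x y u v : #|[set a; x; y]| = 3%N ->
  [set a; x; y] = [set a; u; v] -> (x = u /\ y = v) \/ (x = v /\ y = u).
Proof.
move=> c3 e; have [ax ay xy] := (cards3 a x y).1 c3.
have [au av uv] := (cards3 a u v).1 (etrans (congr1 (fun A : {set T} => #|A|) (esym e)) c3).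
have : x \in [set a; u; v] by rewrite -e !inE eqxx orbT.
have : y \in [set a; u; v] by rewrite -e !inE eqxx orbT.
rewrite !inE ![_ == a]eq_sym (negPf ax) (negPf ay) /=.
case/orP=> /eqP yE /orP[] /eqP xE; first by rewrite xE yE eqxx in xy.
- by right.
- by left.
- by rewrite xE yE eqxx in xy.
Qed.

Lemma set3_third (t : {set T}) u v : #|t| = 3%N -> u \in t -> v \in t -> u != v ->
  exists w, t = [set u; v; w].
Proof.
move=> t3 ut vt uv; have : #|t :\ u :\ v| = 1%N.
  have := cardsD1 u t; have := cardsD1 v (t :\ u).
  by rewrite ut !inE eq_sym uv vt t3 => /=; lia.
move/eqP/cards1P=> [w tE]; exists w; apply/setP => z.
have := congr1 (fun A : {set T} => z \in A) tE; rewrite !inE => <-.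
by case: eqP => [->|]; case: eqP => [->|].
Qed.

Lemma set3_imset (T' : finType) (f : T -> T') x y z :
  f @: [set x; y; z] = [set f x; f y; f z].
Proof. by rewrite !imsetU !imset_set1. Qed.

End Set3.

Definition star_complex n (E : seq ('I_n.+2 * 'I_n.+2)) : complex n.+2 :=
  [set t | has (fun e => [exists i, t == [set i; i + e.1; i + e.2]]) E].

Lemma star_complexP n (E : seq ('I_n.+2 * 'I_n.+2)) t :
  reflect (exists i x y, (x, y) \in E /\ t = [set i; i + x; i + y])
          (t \in star_complex E).
Proof.
rewrite inE; apply: (iffP hasP) => [[[x y] xyE /existsP[i /eqP->]]|[i [x [y [xyE ->]]]]].
  by exists i, x, y.
by exists (x, y) => //; apply/existsP; exists i.
Qed.

Lemma shiftE n (i : 'I_n.+2) : shift i = i + 1.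
Proof. by apply: val_inj; rewrite /= modnDmr addn1. Qed.

(** * Shift-invariant surfaces from the link of 0 *)

Section Surface.
Variables (n : nat) (E : seq ('I_n.+2 * 'I_n.+2)) (N : seq 'I_n.+2).
Hypotheses (lE : link_on E N) (N3 : (2 < size N)%N) (N1 : 1 \in N).
Hypothesis rotE : forall x y, (x, y) \in E ->
  adj E (y - x) (- x) /\ adj E (- y) (x - y).
Let K := star_complex E.

Let uN : uniq N. Proof. by case: lE. Qed.
Let N0 : 0 \notin N. Proof. by case: lE. Qed.
Let pE : perm_eq (unzip1 E ++ unzip2 E) (N ++ N). Proof. by case: lE. Qed.
Let cE : connected_on E N. Proof. by case: lE. Qed.

Lemma adj_rot x y : adj E x y -> adj E (y - x) (- x).
Proof. by case/orP=> /rotE[h1 h2] //; rewrite adjC. Qed.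

Lemma adj_card3 x y : adj E x y -> #|[set 0; x; y]| = 3%N.
Proof.
move=> xy; have [xN yN] := adj_mem pE xy.
apply/cards3; split; last exact: adj_neq uN pE cE N3 _ _ xy.
  by apply: contraNneq N0 => ->.
by apply: contraNneq N0 => ->.
Qed.

Let tr (i z : 'I_n.+2) := i + z.

Lemma translate_set3 (i x y z : 'I_n.+2) :
  tr i @: [set x; y; z] = [set i + x; i + y; i + z].
Proof. by rewrite set3_imset. Qed.

Lemma tri0E i x y : [set i; i + x; i + y] = tr i @: [set 0; x; y].
Proof. by rewrite translate_set3 addr0. Qed.

(** A translate of {0, u, v} contains 0 only for the translations by 0, [- u] and [- v]; closure of
    the link edges under rotation settles the last two. *)
Lemma mem_star0 x y : ([set 0; x; y] \in K) = adj E x y.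
Proof.
apply/idP/idP; last first.
  case/orP=> h; apply/star_complexP.
    by exists 0, x, y; rewrite !add0r.
  by exists 0, y, x; rewrite !add0r set3_swap.
case/star_complexP=> i [u [v [uv]]].
have auv : adj E u v by rewrite /adj uv.
have c3 : #|[set i; i + u; i + v]| = 3%N.
  by rewrite tri0E card_imset ?adj_card3 //; apply: addrI.
move=> e; have : 0 \in [set i; i + u; i + v] by rewrite -e !inE eqxx.
rewrite !inE ![0 == _]eq_sym => /orP[/orP[]|] /eqP i0.
- move: e c3; rewrite i0 !add0r => e c3.
  by case: (set3_inj c3 (esym e)) => -[<- <-] //; rewrite adjC.
- have iE : i = - u by rewrite -[LHS](addrK u) i0 add0r.
  have e' : [set 0; v - u; - u] = [set 0; x; y].
    by rewrite e set3_rot i0 iE [- u + v]addrC.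
  by case: (set3_inj (adj_card3 (adj_rot auv)) e') => -[<- <-]; [|rewrite adjC]; exact: adj_rot.
- have iE : i = - v by rewrite -[LHS](addrK v) i0 add0r.
  have auv2 : adj E (- v) (u - v).
    have := adj_rot (adj_rot auv).
    have -> : - u - (v - u) = - v by ring.
    by rewrite opprB.
  have e' : [set 0; - v; u - v] = [set 0; x; y].
    by rewrite e -set3_rot i0 iE [- v + u]addrC.
  by case: (set3_inj (adj_card3 auv2) e') => -[<- <-] //; rewrite adjC.
Qed.

Lemma mem_star i x y : ([set i; i + x; i + y] \in K) = adj E x y.
Proof.
rewrite -mem_star0; apply/star_complexP/star_complexP.
  case=> j [u [v [uv e]]]; exists (j - i), u, v; split=> //.
  have := congr1 (fun A : {set _} => tr (- i) @: A) e.
  rewrite !set3_imset /tr !addrA addNr !add0r => ->.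
  by rewrite [- i + j]addrC.
case=> j [u [v [uv e]]]; exists (i + j), u, v; split=> //.
by rewrite tri0E e set3_imset /tr !addrA.
Qed.

Lemma star_card3 t : t \in K -> #|t| = 3%N.
Proof.
case/star_complexP=> i [x [y [xy ->]]].
by rewrite tri0E card_imset ?adj_card3 /adj ?xy //; apply: addrI.
Qed.

Lemma mem_star_vertex t u v : t \in K -> u \in t -> v \in t -> u != v ->
  exists2 y, adj E (v - u) y & t = [set u; v; u + y].
Proof.
move=> tK ut vt uv; have [w tE] := set3_third (star_card3 tK) ut vt uv.
have e z : u + (z - u) = z by rewrite addrC subrK.
exists (w - u); last by rewrite e.
by rewrite -(mem_star u) !e -tE.
Qed.

Lemma star_translate t i : t \in K -> tr i @: t \in K.
Proof.
case/star_complexP=> j [x [y [xy ->]]]; rewrite set3_imset /tr !addrA.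
by rewrite mem_star /adj xy.
Qed.

Lemma adjP x : x \in N -> exists2 y, adj E x y & x != y.
Proof.
move=> xN; have := size_nbrs uN pE xN; case e: (nbrs E x) => [//|y l] _.
have xy : adj E x y by rewrite -mem_nbrs e mem_head.
by exists y => //; exact: adj_neq uN pE cE N3 _ _ xy.
Qed.

Lemma star_edge u v : [set u; v] \in edges K -> u != v -> v - u \in N.
Proof.
rewrite inE => /andP[_ /existsP[t /andP[tK /subsetP st]]] uv.
have [y h _] := mem_star_vertex tK (st u (set21 u v)) (st v (set22 u v)) uv.
by case: (adj_mem pE h).
Qed.

Lemma star_surface : closed_surface K.
Proof.
split; first exact: star_card3.
- move=> v; have [y h _] := adjP N1.
  by exists [set v; v + 1; v + y]; rewrite ?mem_star // !inE eqxx.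
- move=> e eK; have := eK; rewrite inE => /andP[/cards2P[u [v [uv ->{eK e}]]]].
  move=> /existsP[t0 /andP[t0K /subsetP st0]].
  have [y0 h0 _] := mem_star_vertex t0K (st0 u (set21 u v)) (st0 v (set22 u v)) uv.
  have [xN _] := adj_mem pE h0.
  have uK : u + (v - u) = v by rewrite addrC subrK.
  pose f y := [set u; v; u + y].
  have fK y : (f y \in K) = adj E (v - u) y by rewrite -(mem_star u) uK.
  have -> : [set t in K | [set u; v] \subset t] = [set t in map f (nbrs E (v - u))].
    apply/setP => t; rewrite [LHS]in_set [RHS]in_set; apply/andP/mapP; last first.
      case=> y; rewrite mem_nbrs => h ->; rewrite fK h; split=> //.
      by apply/subsetP => z; rewrite !inE => /orP[] ->; rewrite ?orbT.
    case=> tK /subsetP st.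
    have [y h ->] := mem_star_vertex tK (st u (set21 u v)) (st v (set22 u v)) uv.
    by exists y; rewrite ?mem_nbrs.
  rewrite cardsE; have/card_uniqP -> : uniq (map f (nbrs E (v - u))).
    rewrite map_inj_in_uniq ?(uniq_nbrs uN pE cE N3) // => y y'.
    rewrite !mem_nbrs => h h' e.
    have c3 : #|[set u; v; u + y]| = 3%N by apply: star_card3; rewrite [_ \in _]fK.
    case: (set3_inj c3 e) => -[]; first by move=> _ /addrI.
    by move=> _ e1; have [_ _] := (cards3 _ _ _).1 c3; rewrite e1 eqxx.
  by rewrite size_map (size_nbrs uN pE).
- move=> v a b ea eb.
  rewrite eq_sym => va; rewrite eq_sym => vb.
  have aN := star_edge ea va; have bN := star_edge eb vb.
  set r := fun x y => _.
  have rC : symmetric r by move=> x y; rewrite /r set3_swap.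
  have vK z : v + (z - v) = z by rewrite addrC subrK.
  (* Reachability from [a] inside the link of [v], read after translation to 0, is constant along
     [E], so [connected_on] applies to it. *)
  have : connect r a (v + (a - v)) = connect r a (v + (b - v)).
    apply: (cE (P := fun z => connect r a (v + z))) => // -[x y] xy /=.
    apply: (same_connect_r (sym_connect_sym rC)).
    by apply: connect1; rewrite /r mem_star /adj xy.
  by rewrite !vK connect0.
move=> u v; set r := fun x y => _.
(* As 1 is a link vertex, [w] and [w + 1] share a triangle, and unit steps reach every vertex. *)
have step w : connect r w (w + 1).
  have [y h _] := adjP N1; apply/connect1/existsP; exists [set w; w + 1; w + y].
  by rewrite mem_star h !inE !eqxx orbT.
have steps k w : connect r w (w + k%:R).
  elim: k w => [|k IH] w; first by rewrite addr0 connect0.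
  by rewrite mulrS addrA; apply: connect_trans (step w) (IH _).
by have := steps (val (v - u)) u; rewrite natr_Zp addrC subrK.
Qed.

Lemma star_cyclic : cyclic_triangulation K.
Proof.
split; [|exact: star_surface|].
  by apply: leq_trans N3 _; rewrite -(card_uniqP uN) -[leqRHS]card_ord max_card.
move=> t tK; have -> : @shift n.+2 @: t = tr 1 @: t.
  by apply: eq_imset => i; rewrite shiftE /tr addrC.
exact: star_translate.
Qed.

Lemma star_equivelar : equivelar (size N) K.
Proof.
move=> v; pose f (e : 'I_n.+2 * 'I_n.+2) := [set v; v + e.1; v + e.2].
have -> : [set t in K | v \in t] = [set t in map f E].
  apply/setP => t; rewrite [LHS]in_set [RHS]in_set; apply/andP/mapP.
    case=> tK vt; have : (0 < #|t :\ v|)%N by have := cardsD1 v t; rewrite vt (star_card3 tK) add1n => -[<-].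
    case/card_gt0P=> u; rewrite !inE => /andP[uv ut].
    have [|y h tE] := mem_star_vertex tK vt ut; first by rewrite eq_sym.
    have vK z : v + (z - v) = z by rewrite addrC subrK.
    case/orP: h => h; [exists (u - v, y) | exists (y, u - v)] => //.
      by rewrite /f /= vK.
    by rewrite /f /= vK set3_swap.
  by case=> -[x y] xy ->; rewrite mem_star /adj xy /f !inE eqxx.
rewrite cardsE; have/card_uniqP -> : uniq (map f E); last by rewrite size_map (size_edges pE).
rewrite map_inj_in_uniq ?(uniq_edges uN pE cE N3) // => -[x y] [x' y'] xy xy' e.
have c3 : #|f (x, y)| = 3%N by apply: star_card3; rewrite mem_star /adj xy.
case: (set3_inj c3 e) => /= -[/addrI e1 /addrI e2]; first by rewrite e1 e2.
by move: (edge_asym uN pE cE N3 xy); rewrite e1 e2 xy'.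
Qed.

End Surface.

(** * Orientable and non-orientable surfaces *)

Lemma dedges_dich n (p : 'I_n * 'I_n * 'I_n) a b c : #|[set a; b; c]| = 3%N ->
  [set p.1.1; p.1.2; p.2] = [set a; b; c] ->
  dedges p =i dedges (a, b, c) \/ dedges p =i dedges (a, c, b).
Proof.
move=> c3 e; case: p e => -[u v] w /= e.
have : u \in [set a; b; c] by rewrite -e !inE eqxx.
rewrite !inE => /orP[/orP[]|] /eqP uE; subst u.
- case: (set3_inj c3 (esym e)) => -[<- <-]; first by left.
  by right.
- move: e c3; rewrite [RHS]set3_rot [[set a; _; _]]set3_rot => e c3.
  case: (set3_inj c3 (esym e)) => -[<- <-]; [left|right] => d.
    by rewrite !inE orbA orbC.
  by rewrite !inE orbC orbA.
- move: e c3; rewrite -[RHS]set3_rot -[[set a; _; _]]set3_rot => e c3.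
  case: (set3_inj c3 (esym e)) => -[<- <-]; [left|right] => d.
    by rewrite !inE orbC orbA.
  by rewrite !inE orbA orbC.
Qed.

Lemma uniq_map_inj_in (T1 T2 : eqType) (f : T1 -> T2) (s : seq T1) :
  uniq (map f s) -> {in s &, injective f}.
Proof.
elim: s => //= z s IH /andP[zs us] x y; rewrite !inE.
case/predU1P=> [->|xs] /predU1P[->|ys] // e; last exact: IH.
  by rewrite e map_f in zs.
by rewrite -e map_f in zs.
Qed.

Section Orientation.
Variables (n : nat) (E : seq ('I_n.+2 * 'I_n.+2)) (N : seq 'I_n.+2).
Hypotheses (uN : uniq N) (cohE : coherent E N) (sgn : 'I_n.+2 -> bool).
Hypothesis sgnD : forall x y, sgn (x + y) = sgn x (+) sgn y.
Hypothesis rotE : forall x y, (x, y) \in E ->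
  flip (sgn x) (y - x, - x) \in E /\ flip (sgn y) (- y, x - y) \in E.

(** The direction of the triangle is read off after moving [i] to 0, a translation that reverses it
    when [sgn i]. By [positive_rot] the choice of the vertex moved to 0 does not matter. *)
Definition positive (i j k : 'I_n.+2) := flip (sgn i) (j - i, k - i) \in E.

Lemma positive_rot i j k : positive i j k -> positive j k i.
Proof.
have sj : sgn j = sgn i (+) sgn (j - i) by rewrite -sgnD addrC subrK.
rewrite /positive sj; have e1 : k - i - (j - i) = k - j by ring.
have e2 : - (j - i) = i - j by ring.
by case: (sgn i) => /= /rotE[]; rewrite e1 e2; case: (sgn (j - i)) => h1 h2.
Qed.

(** Coherence lets [j - i] be a tail (a head when [sgn i]) of one link edge only. So a directed edge
    determines its positive triangle, which is the coherence of the orientation of the surface. *)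
Lemma positive_inj i j k k' : positive i j k -> positive i j k' -> k = k'.
Proof.
have [h t] := andP cohE.
have u1 : uniq (unzip1 E) by rewrite (perm_uniq h).
have u2 : uniq (unzip2 E) by rewrite (perm_uniq t).
rewrite /positive; case: (sgn i) => /= h1 h2; apply: (addIr (- i)).
  exact: (congr1 fst (uniq_map_inj_in u2 h1 h2 erefl)).
exact: (congr1 snd (uniq_map_inj_in u1 h1 h2 erefl)).
Qed.

Lemma orientable_star : orientable (star_complex E).
Proof.
pose good t (p : 'I_n.+2 * 'I_n.+2 * 'I_n.+2) :=
  positive p.1.1 p.1.2 p.2 && (t == [set p.1.1; p.1.2; p.2]).
pose o t := odflt (0, 0, 0) [pick p | good t p].
have oP t : t \in star_complex E -> good t (o t).
  case/star_complexP=> i [x [y [xy ->]]]; rewrite /o; case: pickP => //= H.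
  have e z : i + z - i = z by rewrite addrC addKr.
  have := H (if sgn i then (i, i + y, i + x) else (i, i + x, i + y)).
  rewrite /good /positive; case si: (sgn i); rewrite /= si /= !e xy /=.
    by rewrite set3_swap eqxx.
  by rewrite eqxx.
have dP t d : t \in star_complex E -> d \in dedges (o t) ->
    exists2 w, positive d.1 d.2 w & t = [set d.1; d.2; w].
  move=> /oP; case: (o t) => -[a b] c /andP[/= pos /eqP tE].
  rewrite !inE => /or3P[] /eqP -> /=.
  - by exists c.
  - by exists a; [exact: positive_rot|rewrite -set3_rot].
  - by exists b; [do 2!apply: positive_rot|rewrite set3_rot].
exists o; split=> [t /oP/andP[_ /eqP]//|t1 t2 d K1 K2].
move=> neq d1; apply/negP => d2; case/negP: neq; apply/eqP.
have [w p1 ->] := dP _ _ K1 d1; have [w' p2 ->] := dP _ _ K2 d2.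
by rewrite (positive_inj p1 p2).
Qed.

End Orientation.

Section Moebius.
Variables (n : nat) (K : complex n.+2).
Hypothesis K3 : forall t, t \in K -> #|t| = 3%N.
Variables (x : 'I_n.+2) (m : nat).
Hypothesis xK : forall i, [set i; i + x; i + (x + x)] \in K.
Hypotheses (om : odd m) (mx : x *+ m = 0) (x3 : x + x + x != 0).

(* The triangles {jx, (j+1)x, (j+2)x}, j < m, form a band that is a Moebius
   band because m is odd. *)
Lemma nonorientable_band : ~ orientable K.
Proof.
case=> o [oE ocoh].
pose a j : 'I_n.+2 := x *+ j; pose t j := [set a j; a j.+1; a j.+2].
have tK j : t j \in K.
  by have := xK (a j); rewrite /t /a !mulrSr addrA.
(* The edge from [a j.+1] to [a j.+2] is common to [t j] and [t j.+1]; it is traversed forward in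
   [t j] when [eps j], and in [t j.+1] when [eps j.+1]. An orientation forces [eps] to alternate,
   which an odd period [m] forbids. *)
pose eps j := (a j, a j.+1) \in dedges (o (t j)).
have tneq j : t j != t j.+1.
  apply/eqP => e; have := K3 (tK j); rewrite /t.
  have : a j.+3 \in t j by rewrite e /t !inE eqxx !orbT.
  have := (cards3 _ _ _).1 (K3 (tK j.+1)); rewrite ![_ == a j.+3]eq_sym => -[_ n1 n2].
  rewrite /t !inE (negPf n1) (negPf n2) !orbF.
  have -> : a j.+3 = a j + (x + x + x) by rewrite /a !mulrSr !addrA.
  by rewrite -subr_eq0 addrC addKr (negPf x3).
have dich j : (eps j -> (a j.+1, a j.+2) \in dedges (o (t j))) /\
    (~~ eps j -> (a j.+2, a j.+1) \in dedges (o (t j)) /\ (a j.+1, a j) \in dedges (o (t j))).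
  have c3 := K3 (tK j); have := oE _ (tK j) => e.
  case: (dedges_dich c3 e) => de; rewrite /eps !de !inE !eqxx ?orbT //=.
  have [n1 n2 n3] := (cards3 _ _ _).1 c3.
  rewrite !xpair_eqE (negPf n1) (negPf n2) (negPf n3) ?andbF /=.
  by rewrite !eqxx ?orbT.
have epsS j : eps j.+1 = ~~ eps j.
  have [d1 d2] := dich j; have [d3 d4] := dich j.+1.
  apply/idP/idP => [e1|ne]; last first.
    have [h _] := d2 ne; apply: contraT => /d4[_ h'].
    by have := ocoh _ _ _ (tK j) (tK j.+1) (tneq j) h; rewrite h'.
  apply/negP => /d1 h; have := ocoh _ _ _ (tK j) (tK j.+1) (tneq j) h.
  by rewrite -/(eps j.+1) e1.
have epsE j : eps j = odd j (+) eps 0 by elim: j => //= j IH; rewrite epsS IH addNb.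
have : eps m = eps 0 by rewrite /eps /t /a !mulrSr mx !add0r.
by rewrite epsE om; case: (eps 0).
Qed.

End Moebius.

(** * From the lattice Z x Z_L to Z_n *)

Lemma connected_on_map (T1 T2 : eqType) (f : T1 -> T2) E N :
  connected_on E N ->
  connected_on [seq (f e.1, f e.2) | e <- E] (map f N).
Proof.
move=> cE P PE _ _ /mapP[x xN ->] /mapP[y yN ->].
apply: (cE (fun z => P (f z))) => // e eE.
exact: (PE (f e.1, f e.2) (map_f (fun e => (f e.1, f e.2)) eE)).
Qed.

Section Transfer.
Variables (G H : comNzRingType) (f : G -> H) (sG : G -> bool) (sH : H -> bool).
Hypothesis fB : forall x y, f (x - y) = f x - f y.
Hypothesis fs : forall x, sH (f x) = sG x.

Let f2 (e : G * G) := (f e.1, f e.2).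

Let f0 : f 0 = 0. Proof. by rewrite -(subrr 0) fB subrr. Qed.
Let fN x : f (- x) = - f x. Proof. by rewrite -sub0r fB f0 sub0r. Qed.

Lemma star_map ts hs :
  star sH (map f2 ts) (map f hs) = map f2 (star sG ts hs).
Proof.
rewrite /star map_cat map_flatten -!map_comp; congr (flatten _ ++ _).
  apply: eq_map => -[a c]; rewrite /corners /f2 /= !fs.
  by case: (sG a); case: (sG c); rewrite /= !fB !fN.
by apply: eq_map => h; rewrite /f2 /= fN.
Qed.

(** Only finitely many elements have to stay distinct, so reduction to a large Z_n qualifies; 0 is
    among them so that no link vertex is sent to 0. *)
Lemma link_on_map E N : link_on E N -> {in 0 :: N &, injective f} ->
  link_on (map f2 E) (map f N).
Proof.
case=> uN N0 pE cE inj; split.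
- by rewrite map_inj_in_uniq // => x y xN yN; apply: inj; rewrite inE ?xN ?yN orbT.
- apply/mapP => -[x xN]; rewrite -f0 => /inj; rewrite !inE eqxx xN orbT => h.
  by rewrite h // xN in N0.
- have -> : unzip1 (map f2 E) ++ unzip2 (map f2 E) = map f (unzip1 E ++ unzip2 E).
    by rewrite map_cat /unzip1 /unzip2 -!map_comp.
  by rewrite -map_cat perm_map.
exact: connected_on_map cE.
Qed.

Lemma coherent_map E N : coherent E N -> coherent (map f2 E) (map f N).
Proof.
case/andP=> h t; apply/andP.
have -> : unzip1 (map f2 E) = map f (unzip1 E) by rewrite /unzip1 -!map_comp.
have -> : unzip2 (map f2 E) = map f (unzip2 E) by rewrite /unzip2 -!map_comp.
by split; apply: perm_map.
Qed.

End Transfer.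

Section Lattice.
Variable l : nat.
Let G := (int * 'I_l.+2)%type.

(* The parity of i + j s, where r is the parity of s; trivial unless t. *)
Definition lattice_sgn (t r : bool) (x : G) :=
  t && (odd (absz x.1) (+) (r && odd x.2)).

Lemma lattice_sgnD t r : ~~ odd l ->
  forall x y, lattice_sgn t r (x + y) = lattice_sgn t r x (+) lattice_sgn t r y.
Proof.
move=> el [i j] [i' j']; rewrite /lattice_sgn /=; case: t => //=.
have -> : odd ((j + j') %% l.+2) = odd j (+) odd j'.
  by rewrite -oddD [in RHS](divn_eq (j + j') l.+2) oddD oddM /= negbK (negPf el) andbF.
have -> : odd (absz (i + i')) = odd (absz i) (+) odd (absz i') by lia.
by case: r => /=; case: (odd _); case: (odd _); case: (odd _); case: (odd _).
Qed.

(** Up to sign, the first coordinates of the fresh elements lie within [2 * B] of [4 * B + 4],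
    [16 * B + 16] or [20 * B + 20]: three disjoint ranges beyond [B]. Within a range they may agree,
    when [a], [c] or [a - c] is torsion, and then [a != 0], [c != 0], [a != c] separate them. Both
    constants are even, so [w] and [v] have trivial sign. *)
Lemma fresh_lattice (B : nat) (N : seq G) (a c : G) :
    (forall x, x \in N -> absz x.1 <= B)%N ->
    a \in N -> c \in N -> a != 0 -> c != 0 -> a != c ->
  let w := ((4 * B + 4)%N%:Z, 0) in let v := ((16 * B + 16)%N%:Z, 0) in
  uniq N -> uniq (fresh a c w v ++ N) /\ 0 \notin fresh a c w v.
Proof.
move=> NB aN cN a0 c0 ac w v uN.
have aB : (absz (@fst int 'I_l.+2 a) <= B)%N := NB a aN.
have cB : (absz (@fst int 'I_l.+2 c) <= B)%N := NB c cN.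
have fD (x y : G) : (x + y).1 = (x.1 + y.1 :> int) by [].
have fN (x : G) : (- x).1 = (- x.1 :> int) by [].
have [wE vE] : w.1 = (4 * B + 4)%N%:Z /\ v.1 = (16 * B + 16)%N%:Z by [].
have F0 x : x \in fresh a c w v -> (B < absz x.1)%N.
  rewrite !inE; do ![case/orP]; move/eqP=> ->; rewrite ?(fD, fN) ?wE ?vE; clear -aB cB; lia.
split; last by apply/negP => /F0; rewrite ltn0.
rewrite cat_uniq uN andbT; apply/andP; split; last first.
  by apply/hasPn => x /NB xB; apply/negP => /F0; rewrite ltnNge xB.
have neq (x y : G) : (x.1 <> y.1 :> int) -> x != y by move=> h; apply/eqP => /(congr1 fst).
have wa : w != w - a by apply: contraNneq a0 => /eqP; rewrite -subr_eq0 opprB addrC subrK.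
have wc : w != w - c by apply: contraNneq c0 => /eqP; rewrite -subr_eq0 opprB addrC subrK.
have wac : w - a != w - c by rewrite (inj_eq (addrI _)) eqr_opp.
have vb : v != c - a + v by rewrite -[X in X != _]add0r (inj_eq (addIr _)) eq_sym subr_eq0 eq_sym.
have N1 : - w != a - w by rewrite -[a - w]opprB eqr_opp.
have N2 : - w != c - w by rewrite -[c - w]opprB eqr_opp.
have N3 : a - w != c - w by rewrite (inj_eq (addIr _)).
have N4 : - v != a - c - v.
  have -> : a - c - v = - (c - a + v) by ring.
  rewrite eqr_opp.
  exact: vb.
rewrite /fresh /= !inE !negb_or.
do ![apply/andP; split] => //;
  first [exact: wa | exact: wc | exact: wac | exact: vb | exact: N1 | exact: N2
    | exact: N3 | exact: N4
    | apply: neq; rewrite ?(fD, fN) ?wE ?vE; clear -aB cB; lia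
    | rewrite wE vE; clear; lia].
Qed.

End Lattice.

(** * Families of complexes on Z_n *)

Section LatticeMap.
Variables (l n s : nat).
Hypothesis nE : n.+2 = (l.+2 * s)%N.
Let G := (int * 'I_l.+2)%type.

(* Data over Z x Z_L specialise to Z_n for every n = L s; the torsion part gives
   access to n/2, n/3 and n/4. *)
Definition lattice_map (x : G) : 'I_n.+2 := x.1%:~R + (x.2 * s)%:R.

Lemma val_natr k : val (k%:R : 'I_n.+2) = (k %% n.+2)%N.
Proof. exact: (@val_Zp_nat n.+2). Qed.

Lemma natr_ord_eq0 k : ((k%:R : 'I_n.+2) == 0) = (n.+2 %| k)%N.
Proof. by rewrite -val_eqE val_natr. Qed.

Lemma lattice_mapB x y : lattice_map (x - y) = lattice_map x - lattice_map y.
Proof.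
have D u v : lattice_map (u + v) = lattice_map u + lattice_map v.
  case: u v => [i j] [i' j']; rewrite /lattice_map /= rmorphD /= addrACA; congr (_ + _).
  rewrite -natrD -mulnDl [in RHS](divn_eq (j + j') l.+2) mulnDl natrD -[LHS]add0r.
  congr (_ + _); apply/esym/eqP; rewrite natr_ord_eq0 -mulnA -nE; exact: dvdn_mull.
by apply: (addIr (lattice_map y)); rewrite -D !subrK.
Qed.

(** The image is congruent to [z.1] modulo [s], so it vanishes only if [z.1 = 0]; then [z.2 * s] is
    a multiple of [n.+2] below [n.+2]. *)
Lemma lattice_map0 z : lattice_map z = 0 -> (absz z.1 < s)%N -> z = 0.
Proof.
case: z => [i j]; rewrite /lattice_map /= => e ltis.
have ltj := ltn_ord j; have s0 : (0 < s)%N by case: (absz i) ltis; case: (s).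
have js : (j * s <= l.+1 * s)%N by rewrite leq_mul2r -ltnS ltj orbT.
have j0 : (j * s = 0)%N -> j = 0 :> 'I_l.+2.
  by move/eqP; rewrite muln_eq0 (gtn_eqF s0) orbF => /eqP h; apply: val_inj.
case: i e ltis => a /=.
  rewrite -[a%:~R]/(a%:R) -natrD => /eqP; rewrite natr_ord_eq0 => dv lta.
  have lt : (a + j * s < n.+2)%N by rewrite nE mulSn -addSn leq_add.
  have : (a + j * s = 0)%N.
    by apply/eqP; apply: contraTT dv; rewrite -lt0n => h; rewrite gtnNdvd.
  move=> /eqP; rewrite addn_eq0 => /andP[/eqP-> /eqP/j0 h2].
  congr (_, _). exact: h2.
rewrite NegzE mulrNz => /eqP; rewrite addrC subr_eq0 => /eqP e lta.
have : (j * s = a.+1)%N.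
  have := congr1 val e; rewrite -[(Posz a.+1)%:~R]/(a.+1%:R) !val_natr !modn_small // nE mulSn; lia.
case: (val j) => [|j'] /=; first by rewrite mul0n.
by rewrite mulSn; lia.
Qed.

Lemma lattice_map_inj x y : (2 * absz x.1 < s)%N -> (2 * absz y.1 < s)%N ->
  lattice_map x = lattice_map y -> x = y.
Proof.
case: x y => [i j] [i' j'] /= hx hy e; apply/eqP; rewrite -subr_eq0; apply/eqP.
apply: lattice_map0; first by rewrite lattice_mapB e subrr.
rewrite -[_.1]/((i - i') : int); lia.
Qed.

Hypothesis el : ~~ odd l.

Lemma odd_ordD (i j : 'I_n.+2) : odd (i + j)%R = odd i (+) odd j.
Proof.
have en : ~~ odd n by move: nE => /(congr1 odd); rewrite oddM /= !negbK (negPf el) => ->.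
by rewrite /= -oddD [in RHS](divn_eq (i + j) n.+2) oddD oddM /= negbK (negPf en) andbF.
Qed.

Lemma odd_natr k : odd (k%:R : 'I_n.+2) = odd k.
Proof.
have en : ~~ odd n by move: nE => /(congr1 odd); rewrite oddM /= !negbK (negPf el) => ->.
by rewrite val_natr [in RHS](divn_eq k n.+2) oddD oddM /= negbK (negPf en) andbF.
Qed.

Lemma odd_lattice_map t x : t && odd (lattice_map x) = lattice_sgn t (odd s) x.
Proof.
case: x => [i j]; rewrite /lattice_map /lattice_sgn /= odd_ordD odd_natr oddM andbC.
rewrite [X in _ (+) X]andbC andbC; congr (_ && (_ (+) _)).
case: i => a; first exact: odd_natr.
have := odd_ordD (Negz a)%:~R (a.+1%:R).
rewrite NegzE mulrNz -[(Posz a.+1)%:~R]/(a.+1%:R) addNr odd_natr.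
by rewrite abszN absz_nat /=; case: (odd _); case: (odd _).
Qed.

End LatticeMap.

Definition lattice_data l (sgn : int * 'I_l.+2 -> bool) ts hs N :=
  [/\ link_on (star sgn ts hs) N, (1, 0) \in N, (2 < size N)%N
    & forall h, h \in hs -> h + h + h = 0 /\ sgn h = false].

Lemma star_head_mem l (sgn : int * 'I_l.+2 -> bool) a c ts hs N :
    sgn a = false -> sgn c = false -> link_on (star sgn ((a, c) :: ts) hs) N ->
  [/\ a \in N, c \in N, c - a \in N & - a \in N].
Proof.
move=> sa sc [_ _ pE _].
have VN x : x \in unzip1 (star sgn ((a, c) :: ts) hs) ++ unzip2 (star sgn ((a, c) :: ts) hs) -> x \in N.
  by rewrite (perm_mem pE) mem_cat orbb.
by split; apply: VN; rewrite star_markedE // mem_cat /= !(inE, mem_cat) eqxx ?orbT.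
Qed.

Lemma lattice_data_handle l t r ts hs N a c :
    let sgn := @lattice_sgn l t r in
    ~~ odd l -> sgn a = false -> sgn c = false ->
    lattice_data sgn ((a, c) :: ts) hs N ->
  exists w v, [/\ sgn w = false, sgn v = false,
    lattice_data sgn (handle a c w v ++ ts) hs (fresh a c w v ++ N)
    & coherent (star sgn ((a, c) :: ts) hs) N ->
      coherent (star sgn (handle a c w v ++ ts) hs) (fresh a c w v ++ N)].
Proof.
move=> sgn el sa sc [lE N1 N3 hs3].
have [aN cN baN _] := star_head_mem sa sc lE.
have [uN N0 _ _] := lE.
have nz x : x \in N -> x != 0 by apply: contraTneq => ->.
have ac : a != c by rewrite eq_sym -subr_eq0 nz.
pose B := \max_(x <- N) absz x.1.
have NB x : x \in N -> (absz x.1 <= B)%N by move=> xN; apply: leq_bigmax_seq.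
have [uF F0] := fresh_lattice NB aN cN (nz _ aN) (nz _ cN) ac uN.
set w := (_, 0) in uF F0; set v := (_, 0) in uF F0; exists w, v.
have sw : sgn w = false by rewrite /sgn /lattice_sgn /= oddD oddM /= andbF; case: (t).
have sv : sgn v = false by rewrite /sgn /lattice_sgn /= oddD oddM /= andbF; case: (t).
split=> //; last by apply: coherent_handle => //; exact: lattice_sgnD.
split=> //; first by apply: link_on_handle => //; exact: lattice_sgnD.
by rewrite mem_cat N1 orbT.
Qed.

(** The first triangle [(a, c)] is set apart as the place for the next handle, hence its trivial
    signs. *)
Definition orientable_data q := exists l t r ts hs N a c,
  let sgn := @lattice_sgn l t r in
  [/\ ~~ odd l, size N = q, sgn a = false /\ sgn c = false,
      lattice_data sgn ((a, c) :: ts) hs N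
    & coherent (star sgn ((a, c) :: ts) hs) N].

(* The last three conditions make the image of x in Z_n an element of odd order
   when n = (l + 2) s with s = 1 mod 4. *)
Definition nonorientable_data q := exists l ts hs N a c x u,
  let sgn := @lattice_sgn l false false in
  [/\ ~~ odd l, size N = q, lattice_data sgn ((a, c) :: ts) hs N,
      (x, x + x) \in ts /\ x + x + x != 0
    & [/\ odd u, l.+2 %| 4 * u & (l.+2 %| absz (x.1 + (x.2 : nat)%:Z)%R * u)]%N].

(** The handle lists [(w, c)] first; its signs are trivial again, so it becomes the new marked
    triangle and the step can be iterated. *)
Lemma orientable_data12 q : orientable_data q -> orientable_data (q + 12).
Proof.
case=> l [t [r [ts [hs [N [a [c [el qE [sa sc] D C]]]]]]]].
have [w [v [sw sv D' C']]] := lattice_data_handle el sa sc D.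
exists l, t, r, ((a, w) :: (a - w, v) :: (v, a - c) :: (w - c, a - c - v) :: ts), hs,
  (fresh a c w v ++ N), w, c; split=> //.
- by rewrite size_cat qE addnC.
exact: C'.
Qed.

Lemma nonorientable_data12 q : nonorientable_data q -> nonorientable_data (q + 12).
Proof.
case=> l [ts [hs [N [a [c [x [u [el qE D [xts x3] X]]]]]]]].
have [w [v [sw sv D' C']]] := @lattice_data_handle l false false ts hs N a c el erefl erefl D.
exists l, ((a, w) :: (a - w, v) :: (v, a - c) :: (w - c, a - c - v) :: ts), hs,
  (fresh a c w v ++ N), w, c, x, u; split=> //.
- by rewrite size_cat qE addnC.
by rewrite !inE xts !orbT.
Qed.

Section Realization.
Variables (l : nat) (t r : bool) (ts : seq ((int * 'I_l.+2) * (int * 'I_l.+2))).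
Variables (hs N : seq (int * 'I_l.+2)) (k : nat).
Let sgn := @lattice_sgn l t r.
Hypotheses (el : ~~ odd l) (D : lattice_data sgn ts hs N).
Hypothesis Nk : forall x, x \in N -> (absz x.1 < k)%N.
(** [s] exceeds twice every first coordinate in [N], which makes [f] injective on [0 :: N]; it has
    the parity [r] that [sgn] presumes, and is 1 modulo 4 when [r] holds. The free [k] produces
    infinitely many sizes. [n] is two less than the number of vertices, so that ['I_n.+2] is a
    ring. *)
Let s := (4 * k + r)%N.
Let n := (l.+2 * s).-2.
Let f := @lattice_map l n s.
Let E := [seq (f e.1, f e.2) | e <- star sgn ts hs].

Definition realization : complex n.+2 := star_complex E.

Let k0 : (0 < k)%N. Proof. by case: D => _ /Nk; case: (k). Qed.
Let nE : n.+2 = (l.+2 * s)%N.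
Proof. by rewrite /n /s; case: (k) k0 => // k' _; rewrite mulSn; lia. Qed.
Let os : odd s = r. Proof. by rewrite /s oddD oddM; case: (r). Qed.
Let sgnf x : t && odd (f x) = sgn x.
Proof. by rewrite /f odd_lattice_map // os. Qed.
Let fB : {morph f : x y / x - y}. Proof. by move=> x y; apply: lattice_mapB. Qed.
Let f0 : f 0 = 0. Proof. by rewrite -(subrr 0) fB subrr. Qed.
Let fD : {morph f : x y / x + y}.
Proof. by move=> x y; apply: (addIr (- f y)); rewrite addrK -fB addrK. Qed.
Let EE : E = star (fun i : 'I_n.+2 => t && odd i)
                 [seq (f e.1, f e.2) | e <- ts] (map f hs).
Proof. by rewrite (star_map fB sgnf). Qed.
Let sgnD (i j : 'I_n.+2) : t && odd (i + j)%R = (t && odd i) (+) (t && odd j).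
Proof. by case: t => //; apply: odd_ordD nE el _ _. Qed.
Let f_inj : {in 0 :: N &, injective f}.
Proof.
have small x : x \in 0 :: N -> (2 * absz x.1 < s)%N.
  rewrite inE => /predU1P[->|/Nk]; first by rewrite muln0 /s; have := k0; clear; lia.
  move=> xk; apply: (@leq_trans (2 * k)%N); first by rewrite ltn_pmul2l.
  by rewrite /s; clear; lia.
by move=> x y /small hx /small hy; apply: lattice_map_inj.
Qed.
Let lE : link_on E (map f N).
Proof. by case: D => lE _ _ _; apply: link_on_map. Qed.
Let hs3 : forall h, h \in map f hs -> h + h + h = 0 /\ t && odd h = false.
Proof.
move=> _ /mapP[h hh ->]; case: D => _ _ _ /(_ h hh)[h3 sh].
by rewrite -!fD h3 sgnf.
Qed.
Let N1 : 1 \in map f N.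
Proof.
by case: D => _ h _ _; have := map_f f h; rewrite /f /lattice_map /= mul0n addr0.
Qed.
Let N3 : (2 < size (map f N))%N. Proof. by rewrite size_map; case: D. Qed.
Let rotE x y : (x, y) \in E ->
  flip (t && odd x) (y - x, - x) \in E /\ flip (t && odd y) (- y, x - y) \in E.
Proof. by rewrite EE; apply: star_rot. Qed.
Let rotA x y : (x, y) \in E -> adj E (y - x) (- x) /\ adj E (- y) (x - y).
Proof.
by move/rotE; case: (t && _); case: (t && _) => -[h1 h2]; rewrite /adj h1 h2 ?orbT.
Qed.

Lemma realization_cyclic : cyclic_triangulation realization.
Proof. exact: star_cyclic lE N3 N1 rotA. Qed.

Lemma realization_equivelar : equivelar (size N) realization.
Proof. by rewrite -(size_map f); apply: star_equivelar lE N3 rotA. Qed.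

Lemma realization_orientable : coherent (star sgn ts hs) N -> orientable realization.
Proof.
move=> C; case: (lE) => uN _ _ _.
exact: (@orientable_star _ E _ uN (coherent_map f C) (fun i => t && odd i) sgnD rotE).
Qed.

Lemma realization_nonorientable x u : r -> (x, x + x) \in ts -> x + x + x != 0 ->
    odd u -> (l.+2 %| 4 * u)%N -> (l.+2 %| absz (x.1 + (x.2 : nat)%:Z)%R * u)%N ->
  ~ orientable realization.
Proof.
move=> r1 xts x3 ou d1 d2.
have xE : (x, x + x) \in star sgn ts hs.
  by rewrite mem_cat; apply/orP; left; apply/flatten_mapP; exists (x, x + x); rewrite ?inE ?eqxx.
have [_ _ pE _] := lE.
have [uN _ pE0 _] : link_on (star sgn ts hs) N by case: D.
have xN : - x \in N.
  have : flip (sgn x) (x + x - x, - x) \in star sgn ts hs.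
    by rewrite mem_cat; apply/orP; left; apply/flatten_mapP; exists (x, x + x); rewrite ?inE ?eqxx ?orbT.
  by case: (sgn x) => /(edge_mem pE0)[].
have [_ x2N] := edge_mem pE0 xE.
apply: (@nonorientable_band _ _ _ (f x) (u * s)).
- exact: star_card3 lE N3.
- move=> i; rewrite (mem_star lE N3 rotA) /adj -fD.
  by rewrite (map_f (fun e => (f e.1, f e.2)) xE).
- by rewrite oddM ou os r1.
(* With [s = 4 * k + 1] and L = [l.+2], the product of [x.1 + x.2 * s] by [u] is
   [(x.1 + x.2) * u + 4 * u * k * x.2], a multiple of L; the further factor [s] makes it a multiple
   of [n.+2], which is L times [s]. *)
- rewrite /f /lattice_map.
  have -> : x.1%:~R + (x.2 * s)%:R = (x.1 + (x.2 * s)%N%:Z)%:~R :> 'I_n.+2 by rewrite rmorphD.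
  have [q1 q1E] : exists q1, (x.1 + (x.2 : nat)%:Z) * u%:Z = q1 * l.+2%:Z.
    by apply/dvdzP; rewrite dvdzE abszM.
  case/dvdnP: d1 => q2 q2E.
  rewrite -mulr_natr -[(u * s)%:R]/((Posz (u * s))%:~R) -intrM.
  have -> : (x.1 + (x.2 * s)%N%:Z) * (u * s)%N%:Z = (q1 + (x.2 * k * q2)%N%:Z) * n.+2%:Z.
    rewrite nE.
    have sE : s%:Z = 4 * k%:Z + 1 by rewrite /s r1; clear; lia.
    have q2E' : 4 * u%:Z = q2%:Z * l.+2%:Z by move: q2E; clear; lia.
    rewrite !PoszM [RHS](_ : _ = (q1 * l.+2%:Z) * s%:Z + (x.2 : nat)%:Z * k%:Z * (q2%:Z * l.+2%:Z) * s%:Z); last by ring.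
    by rewrite -q1E -q2E' {1}sE; ring.
  by rewrite intrM -[(Posz n.+2)%:~R]/(n.+2%:R) [n.+2%:R](eqP (_ : _ == 0)) ?natr_ord_eq0 // mulr0.
rewrite -!fD; apply: contraNneq x3 => e.
have : f (x + x) = f (- x) by apply/eqP; rewrite -subr_eq0 -fB opprK e.
by move/f_inj; rewrite !inE x2N xN !orbT => -> //; rewrite addNr.
Qed.

End Realization.

(** * Base data in eight degrees *)

Lemma link_on_cycle (T : zmodType) (E : seq (T * T)) x N :
  [&& uniq (x :: N), 0 \notin x :: N,
      perm_eq (unzip1 E ++ unzip2 E) ((x :: N) ++ (x :: N)) & path (adj E) x N] ->
  link_on E (x :: N).
Proof.
case/and4P=> uN N0 pE xN; split=> // P PE.
have adjP u v : adj E u v -> P u = P v by case/orP=> /PE.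
have H z : z \in x :: N -> P z = P x.
  elim: N x xN {uN N0 pE} => [|y N IH] x /=; first by rewrite !inE => _ /eqP->.
  case/andP=> /adjP xy yN; rewrite inE => /predU1P[->//|/(IH _ yN)->].
  by rewrite xy.
by move=> u v /H-> /H->.
Qed.

Definition pt l (p : int * int) : int * 'I_l.+2 := (p.1, inZp (absz p.2)).

Definition pts l (T : seq ((int * int) * (int * int))) :=
  [seq (pt l p.1, pt l p.2) | p <- T].

Definition link_check l (sgn : int * 'I_l.+2 -> bool) ts hs N :=
  let E := star sgn ts hs in
  [&& uniq N, 0 \notin N, perm_eq (unzip1 E ++ unzip2 E) (N ++ N),
      path (adj E) (head 0 N) (behead N), (1, 0) \in N, (2 < size N)%N
    & all (fun h => (h + h + h == 0) && ~~ sgn h) hs].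

Lemma link_checkP l sgn ts hs N : @link_check l sgn ts hs N -> lattice_data sgn ts hs N.
Proof.
case/and5P=> h1 h2 h3 h4 /and3P[h5 h6 /allP h7]; split=> //; last first.
  by move=> h /h7/andP[/eqP-> /negPf].
by case: N h1 h2 h3 h4 h5 h6 => // x N h1 h2 h3 h4 _ _; apply: link_on_cycle; apply/and4P.
Qed.

Lemma orientable_base l t r T Hs C :
  (let sgn := @lattice_sgn l t r in let ts := pts l T in let N := map (pt l) C in
   [&& ~~ odd l, (0 < size ts)%N, ~~ sgn (head (0, 0) ts).1, ~~ sgn (head (0, 0) ts).2,
       link_check sgn ts (map (pt l) Hs) N & coherent (star sgn ts (map (pt l) Hs)) N]) ->
  orientable_data (size C).
Proof.
move=> /= /and5P[el + sa sc /andP[/link_checkP D coh]].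
case E: (pts l T) sa sc D coh => [|[a c] ts] //= /negPf sa /negPf sc D coh _.
by exists l, t, r, ts, (map (pt l) Hs), (map (pt l) C), a, c; rewrite size_map.
Qed.

Lemma nonorientable_base l u p T Hs C :
  (let sgn := @lattice_sgn l false false in let ts := pts l T in let x := pt l p in
   [&& ~~ odd l, (0 < size ts)%N, link_check sgn ts (map (pt l) Hs) (map (pt l) C),
       (x, x + x) \in behead ts, x + x + x != 0, odd u, (l.+2 %| 4 * u)%N
     & (l.+2 %| absz (x.1 + (x.2 : nat)%:Z)%R * u)%N]) ->
  nonorientable_data (size C).
Proof.
move=> /= /and5P[el + /link_checkP D xts /and4P[x3 ou d1 d2]].
case E: (pts l T) D xts => [|[a c] ts] //= D xts _.
by exists l, ts, (map (pt l) Hs), (map (pt l) C), a, c, (pt l p), u; rewrite size_map.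
Qed.

(* The lists below come from a computer search; the last one is the link cycle. *)
Lemma nonorientable_6 : nonorientable_data 6.
Proof.
by apply: (@nonorientable_base 0 1 (1, 1)%Z
  [:: ((-1, 0), (-2, 0)); ((1, 1), (2, 0))]%Z
  [::]%Z
  [:: (-1, 0); (-2, 0); (-1, 1); (1, 1); (2, 0); (1, 0)]%Z); vm_compute.
Qed.

Lemma orientable_6 : orientable_data 6.
Proof.
by apply: (@orientable_base 0 false false
  [:: ((-2, 0), (-3, 0)); ((-3, 0), (-1, 0))]%Z
  [::]%Z
  [:: (-2, 0); (-3, 0); (-1, 0); (2, 0); (3, 0); (1, 0)]%Z); vm_compute.
Qed.

Lemma nonorientable_9 : nonorientable_data 9.
Proof.
by apply: (@nonorientable_base 10 3 (-1, 9)%Z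
  [:: ((0, 6), (-1, 0)); ((-1, 9), (-2, 6)); ((-1, 0), (-2, 6))]%Z
  [::]%Z
  [:: (0, 6); (-1, 0); (-2, 6); (-1, 9); (1, 3); (2, 6); (1, 6); (1, 0); (-1, 6)]%Z); vm_compute.
Qed.

Lemma orientable_9 : orientable_data 9.
Proof.
by apply: (@orientable_base 10 true false
  [:: ((0, 6), (-2, 0)); ((1, 9), (-1, 3)); ((-1, 0), (1, 0))]%Z
  [::]%Z
  [:: (0, 6); (-2, 0); (-1, 0); (1, 0); (2, 0); (2, 6); (1, 9); (-1, 3); (-2, 6)]%Z); vm_compute.
Qed.

Lemma orientable_12 : orientable_data 12.
Proof.
by apply: (@orientable_base 0 true true
  [:: ((-3, 1), (-1, 1)); ((1, 0), (3, 0)); ((-2, 1), (-3, 1)); ((3, 0), (1, 1))]%Z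
  [::]%Z
  [:: (1, 0); (3, 0); (1, 1); (-2, 0); (-3, 0); (-2, 1); (-3, 1); (-1, 1); (2, 1); (-1, 0); (2, 0); (3, 1)]%Z); vm_compute.
Qed.

Lemma nonorientable_15 : nonorientable_data 15.
Proof.
by apply: (@nonorientable_base 10 3 (-1, 5)%Z
  [:: ((1, 6), (1, 0)); ((-1, 5), (-2, 10)); ((-1, 0), (-2, 6)); ((0, 8), (-2, 2)); ((0, 4), (2, 2))]%Z
  [::]%Z
  [:: (1, 6); (1, 0); (-1, 6); (0, 6); (-1, 0); (-2, 6); (0, 4); (2, 2); (1, 7); (-1, 5); (-2, 10); (-2, 2); (0, 8); (2, 10); (2, 6)]%Z); vm_compute.
Qed.

Lemma orientable_15 : orientable_data 15.
Proof.
by apply: (@orientable_base 10 true true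
  [:: ((0, 2), (-2, 8)); ((1, 0), (1, 6)); ((-1, 6), (-2, 6)); ((0, 11), (0, 1)); ((-2, 8), (-1, 10))]%Z
  [::]%Z
  [:: (1, 0); (1, 6); (-1, 0); (0, 6); (-1, 6); (-2, 6); (0, 10); (0, 11); (0, 1); (0, 2); (-2, 8); (-1, 10); (1, 2); (2, 4); (2, 6)]%Z); vm_compute.
Qed.

(** Degrees 10, 13, 16 and 19 are 1 modulo 3, so a short orbit appears: its generator is an element
    of order 3 in Z_6 or Z_12. In odd degrees the list of link vertices also contains the involution
    (0, 6) of Z_12. *)
Lemma nonorientable_10 : nonorientable_data 10.
Proof.
by apply: (@nonorientable_base 4 3 (1, 5)%Z
  [:: ((0, 4), (1, 4)); ((1, 5), (2, 4)); ((-1, 2), (-2, 2))]%Z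
  [:: (0, 4)]%Z
  [:: (0, 4); (1, 4); (-1, 0); (-1, 2); (-2, 2); (-1, 1); (1, 5); (2, 4); (1, 0); (0, 2)]%Z); vm_compute.
Qed.

Lemma orientable_10 : orientable_data 10.
Proof.
by apply: (@orientable_base 4 true false
  [:: ((2, 2), (2, 0)); ((-2, 4), (-1, 5)); ((2, 0), (1, 0))]%Z
  [:: (0, 2)]%Z
  [:: (2, 2); (2, 0); (1, 0); (-1, 0); (-2, 0); (0, 2); (0, 4); (-2, 4); (-1, 5); (1, 1)]%Z); vm_compute.
Qed.

Lemma nonorientable_13 : nonorientable_data 13.
Proof.
by apply: (@nonorientable_base 10 3 (1, 11)%Z
  [:: ((0, 8), (0, 2)); ((1, 11), (2, 10)); ((1, 0), (1, 10)); ((-1, 0), (-2, 2))]%Z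
  [:: (0, 8)]%Z
  [:: (0, 8); (0, 2); (-1, 2); (1, 0); (1, 10); (2, 10); (1, 11); (-1, 1); (-2, 2); (-1, 0); (0, 10); (0, 6); (0, 4)]%Z); vm_compute.
Qed.

Lemma orientable_13 : orientable_data 13.
Proof.
by apply: (@orientable_base 10 true false
  [:: ((0, 8), (0, 2)); ((2, 0), (2, 2)); ((-1, 0), (1, 0)); ((2, 2), (1, 1))]%Z
  [:: (0, 4)]%Z
  [:: (0, 8); (0, 2); (-2, 0); (-1, 0); (1, 0); (2, 0); (2, 2); (1, 1); (-1, 11); (-2, 10); (0, 10); (0, 6); (0, 4)]%Z); vm_compute.
Qed.

Lemma nonorientable_16 : nonorientable_data 16.
Proof.
by apply: (@nonorientable_base 4 3 (-1, 3)%Z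
  [:: ((2, 5), (2, 1)); ((-1, 3), (-2, 0)); ((1, 1), (-1, 0)); ((1, 5), (2, 0)); ((-1, 1), (1, 0))]%Z
  [:: (0, 4)]%Z
  [:: (2, 5); (2, 1); (1, 0); (-1, 1); (1, 1); (-1, 0); (-2, 1); (0, 2); (0, 4); (-2, 5); (-1, 5); (-2, 0); (-1, 3); (1, 3); (2, 0); (1, 5)]%Z); vm_compute.
Qed.

Lemma orientable_16 : orientable_data 16.
Proof.
by apply: (@orientable_base 4 true true
  [:: ((0, 2), (2, 2)); ((1, 5), (2, 0)); ((1, 2), (2, 1)); ((1, 0), (-1, 4)); ((-2, 5), (-1, 0))]%Z
  [:: (0, 4)]%Z
  [:: (0, 2); (2, 2); (1, 2); (2, 1); (1, 1); (-1, 1); (-2, 5); (-1, 0); (-2, 4); (-2, 0); (-1, 5); (1, 0); (-1, 4); (1, 5); (2, 0); (0, 4)]%Z); vm_compute.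
Qed.

Lemma nonorientable_19 : nonorientable_data 19.
Proof.
by apply: (@nonorientable_base 10 3 (1, 7)%Z
  [:: ((0, 6), (0, 10)); ((1, 7), (2, 2)); ((0, 10), (-3, 6)); ((1, 4), (-2, 10)); ((3, 4), (1, 0)); ((-1, 8), (1, 0))]%Z
  [:: (0, 8)]%Z
  [:: (0, 6); (0, 10); (-3, 6); (-1, 8); (1, 0); (3, 4); (3, 6); (2, 2); (1, 7); (-1, 5); (-2, 10); (1, 4); (2, 4); (-1, 0); (-2, 8); (-3, 8); (0, 2); (0, 8); (0, 4)]%Z); vm_compute.
Qed.

Lemma orientable_19 : orientable_data 19.
Proof.
by apply: (@orientable_base 10 true true
  [:: ((0, 8), (0, 2)); ((1, 10), (1, 8)); ((1, 8), (2, 6)); ((2, 3), (0, 9)); ((2, 0), (2, 3)); ((-2, 0), (-1, 0))]%Z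
  [:: (0, 4)]%Z
  [:: (0, 8); (0, 2); (-1, 4); (1, 10); (1, 8); (2, 6); (0, 3); (-2, 0); (-1, 0); (1, 0); (2, 0); (2, 3); (0, 9); (-2, 9); (-2, 6); (-1, 2); (0, 10); (0, 6); (0, 4)]%Z); vm_compute.
Qed.

Lemma nonorientable_12 : nonorientable_data 12.
Proof.
by apply: (@nonorientable_base 0 1 (-2, 0)%Z
  [:: ((3, 0), (2, 1)); ((-2, 0), (-4, 0)); ((1, 1), (-1, 0)); ((1, 0), (4, 0))]%Z
  [::]%Z
  [:: (3, 0); (2, 1); (1, 0); (4, 0); (2, 0); (-2, 0); (-4, 0); (-3, 0); (-1, 1); (-2, 1); (1, 1); (-1, 0)]%Z); vm_compute.
Qed.

(** * Infinite families in all degrees *)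

Lemma isomorphic_size n m (K : complex n) (L : complex m) : isomorphic K L -> n = m.
Proof. by case=> f [fb _]; have := bij_eq_card fb; rewrite !card_ord. Qed.

Lemma lattice_bound l (N : seq (int * 'I_l.+2)) :
  exists B, forall i x, x \in N -> (absz x.1 < B + i)%N.
Proof.
exists (\max_(x <- N) absz x.1).+1 => i x xN.
by rewrite addSn ltnS; apply: leq_trans (leq_addr _ _); apply: leq_bigmax_seq.
Qed.

Lemma size_inj l (r : bool) B i j : (0 < B)%N ->
  (l.+2 * (4 * (B + i) + r)).-2.+2 = (l.+2 * (4 * (B + j) + r)).-2.+2 -> i = j.
Proof.
move=> B0; have P k : (l.+2 * (4 * (B + k) + r)).-2.+2 = (l.+2 * (4 * (B + k) + r))%N.
  by case: (B) B0 => // B' _; rewrite mulSn mulnC; lia.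
by rewrite !P => /eqP; rewrite eqn_mul2l /= => /eqP; lia.
Qed.

Lemma orientable_family q : orientable_data q ->
  exists (nf : nat -> nat) (Kf : forall i, complex (nf i)),
    (forall i, [/\ cyclic_triangulation (Kf i), equivelar q (Kf i) & orientable (Kf i)]) /\
    (forall i j, i <> j -> ~ isomorphic (Kf i) (Kf j)).
Proof.
case=> l [t [r [ts [hs [N [a [c [el <- [sa sc] D coh]]]]]]]].
have [B NB] := lattice_bound N; have B0 : (0 < B)%N.
  by case: (D) => _ /(NB 0%N); rewrite addn0; case: (B).
exists (fun i => (l.+2 * (4 * (B + i) + r)).-2.+2).
exists (fun i => realization t r ((a, c) :: ts) hs (B + i)); split=> [i|i j ij].
  split; [exact: realization_cyclic el D (NB i) | exact: realization_equivelar el D (NB i) |].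
  exact: realization_orientable el D (NB i) coh.
by move/isomorphic_size => h; apply: ij; apply: size_inj B0 h.
Qed.

Lemma nonorientable_family q : nonorientable_data q ->
  exists (nf : nat -> nat) (Kf : forall i, complex (nf i)),
    (forall i, [/\ cyclic_triangulation (Kf i), equivelar q (Kf i) & ~ orientable (Kf i)]) /\
    (forall i j, i <> j -> ~ isomorphic (Kf i) (Kf j)).
Proof.
case=> l [ts [hs [N [a [c [x [u [el <- D [xts x3] [ou d1 d2]]]]]]]]].
have [B NB] := lattice_bound N; have B0 : (0 < B)%N.
  by case: (D) => _ /(NB 0%N); rewrite addn0; case: (B).
exists (fun i => (l.+2 * (4 * (B + i) + true)).-2.+2).
(* With [t = false] the sign is trivial whatever [r] is, so the same data serve for an odd [s]. *)
have D' : lattice_data (@lattice_sgn l false true) ((a, c) :: ts) hs N by exact: D.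
exists (fun i => @realization l false true ((a, c) :: ts) hs (B + i)); split=> [i|i j ij].
  split; [exact: realization_cyclic el D' (NB i) | exact: realization_equivelar el D' (NB i) |].
  by apply: (realization_nonorientable el D' (NB i) _ _ x3 ou d1 d2); rewrite // inE xts orbT.
by move/isomorphic_size => h; apply: ij; apply: (@size_inj l true B i j B0 h).
Qed.

(** Each of the residues 0, 1, 3, 4, 6, 7, 9, 10 modulo 12 is represented by its least admissible
    degree; for 7 this is 19. The only other admissible degree up to 19 is 18 = 6 + 12. *)
Lemma mod12_ind (P : nat -> Prop) : (forall q, P q -> P (q + 12)%N) ->
    P 6%N -> P 9%N -> P 12%N -> P 15%N -> P 10%N -> P 13%N -> P 16%N -> P 19%N ->
  forall q, (exists2 k, (2 <= k)%N & q = (3 * k)%N) \/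
            (exists2 k, (3 <= k)%N & q = (3 * k + 1)%N) -> P q.
Proof.
move=> P12 P6 P9 P12_ P15 P10 P13 P16 P19 q.
have [m] := ubnP q; elim: m q => // m IH q lt H.
have [qs|ql] := leqP q 19; last first.
  have -> : q = (q - 12 + 12)%N by lia.
  apply/P12/IH; first by lia.
  case: H => -[k hk qE]; [left | right]; exists (k - 4)%N; lia.
have : q \in [:: 6; 9; 12; 15; 10; 13; 16; 19; 18]%N.
  by case: H => -[k hk qE]; rewrite !inE; lia.
rewrite !inE.
do ![case/predU1P=> [-> //|]]; move/eqP=> qE.
by rewrite qE; exact: (P12 6%N).
Qed.

(** * Counting faces, and complexes given by generators *)

Lemma double_counting (I J : finType) (A : {set I}) (B : {set J}) (r : I -> J -> bool) :
  (\sum_(i in A) #|[set j in B | r i j]| = \sum_(j in B) #|[set i in A | r i j]|)%N.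
Proof.
transitivity (\sum_(i in A) \sum_(j | (j \in B) && r i j) 1)%N.
  by apply: eq_bigr => i _; rewrite -sum1_card; apply: eq_bigl => j; rewrite inE.
rewrite (exchange_big_dep (mem B)) => [|i j _ /andP[]//] /=.
apply: eq_bigr => j jB; rewrite -sum1_card; apply: eq_bigl => i.
by rewrite inE jB.
Qed.

Section Counting.
Variables (n q : nat) (K : complex n).
Hypotheses (sK : closed_surface K) (qK : equivelar q K).

Lemma card_triangles : (#|K| * 3 = n * q)%N.
Proof.
have [K3 _ _ _ _] := sK.
have := double_counting [set: 'I_n] K (fun v t => v \in t).
rewrite (eq_bigr (fun=> q)) => [|v _]; last exact: qK.
rewrite sum_nat_const cardsT card_ord => ->.
rewrite (eq_bigr (fun=> 3%N)) ?sum_nat_const // => t /K3 <-.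
by apply: eq_card => v; rewrite !inE.
Qed.

Lemma card_edges : (#|edges K| * 2 = #|K| * 3)%N.
Proof.
have [K3 _ K2 _ _] := sK.
have := double_counting (edges K) K (fun e t => e \subset t).
rewrite (eq_bigr (fun=> 2%N)) => [|e eK]; last exact: K2.
rewrite sum_nat_const => ->.
rewrite (eq_bigr (fun=> 3%N)) ?sum_nat_const // => t tK.
rewrite -[RHS]/'C(3, 2) -(K3 t tK) -cards_draws; apply: eq_card => e; rewrite !inE.
case: (boolP (e \subset t)) => et; rewrite ?andbT ?andbF //= andb_idr // => _.
by apply/existsP; exists t; rewrite tK.
Qed.

End Counting.

Lemma star_complex_sub n (E E' : seq ('I_n.+2 * 'I_n.+2)) :
  (forall x y, (x, y) \in E -> adj E' x y) -> star_complex E \subset star_complex E'.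
Proof.
move=> EE'; apply/subsetP => t /star_complexP[i [x [y [xy ->]]]].
case/orP: (EE' x y xy) => h; apply/star_complexP; first by exists i, x, y.
by exists i, y, x; rewrite set3_swap.
Qed.

Lemma star_complex_generators n (sgn : 'I_n.+2 -> bool) ts hs :
  star_complex (star sgn ts hs) = star_complex (ts ++ [seq (h, - h) | h <- hs]).
Proof.
apply/eqP; rewrite eqEsubset; apply/andP; split; last first.
  apply: star_complex_sub => x y; rewrite /adj !mem_cat => /orP[h|->]; last by rewrite orbT.
  apply/orP; left; apply/orP; left; apply/flatten_mapP; exists (x, y) => //.
  by rewrite /corners inE eqxx.
apply/subsetP => t /star_complexP[i [x [y [+ ->]]]]; rewrite mem_cat => /orP[|h]; last first.
  by apply/star_complexP; exists i, x, y; rewrite mem_cat h orbT.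
case/flatten_mapP=> -[a c] acs H.
suff [j ->] : exists j, [set i; i + x; i + y] = [set j; j + a; j + c].
  by apply/star_complexP; exists j, a, c; rewrite mem_cat acs.
move: H; rewrite /corners !inE /= => /or3P[] /eqP.
- by case=> -> ->; exists i.
- have e : [set i; i + (c - a); i + - a] = [set i - a; i - a + a; i - a + c].
    by rewrite subrK [in RHS]set3_rot addrA addrAC.
  by case: (sgn a) => -[-> ->]; exists (i - a); rewrite -e // set3_swap.
- have e : [set i; i + - c; i + (a - c)] = [set i - c; i - c + a; i - c + c].
    by rewrite subrK -[in RHS]set3_rot addrA addrAC.
  by case: (sgn c) => -[-> ->]; exists (i - c); rewrite -e // set3_swap.
Qed.

Lemma generated_star n (l : seq (nat * nat)) :
  generated n.+1 [seq (0%N, p.1, p.2) | p <- l] =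
  star_complex [seq (vmod n.+1 p.1, vmod n.+1 p.2) | p <- l].
Proof.
have vD a (i : 'I_n.+2) : vmod n.+1 (a + i) = i + vmod n.+1 a.
  by apply: val_inj; rewrite /= modnDmr addnC.
have v0 : vmod n.+1 0 = 0 by apply: val_inj.
have key (i : 'I_n.+2) (p : nat * nat) :
  [set vmod n.+1 (0 + i); vmod n.+1 (p.1 + i); vmod n.+1 (p.2 + i)]
   = [set i; i + vmod n.+1 p.1; i + vmod n.+1 p.2] by rewrite !vD v0 addr0.
rewrite /generated; apply/setP => t; apply/idP/star_complexP.
  rewrite big_map; elim: l => [|p l IH]; first by rewrite big_nil inE.
  rewrite big_cons inE => /orP[/imsetP[i _ ->]|/IH[i [x [y [xy ->]]]]].
    by exists i, (vmod n.+1 p.1), (vmod n.+1 p.2); rewrite key inE eqxx.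
  by exists i, x, y; rewrite inE xy orbT.
case=> i [x [y [/mapP[p pl [-> ->]] ->]]].
rewrite big_map (big_rem p pl) inE; apply/orP; left; apply/imsetP.
by exists i; rewrite // -key.
Qed.

Definition star_check n (sgn : 'I_n.+2 -> bool) ts hs N :=
  let E := star sgn ts hs in
  [&& uniq N, 0 \notin N, perm_eq (unzip1 E ++ unzip2 E) (N ++ N),
      path (adj E) (head 0 N) (behead N), 1 \in N, (2 < size N)%N,
      all (fun h => (h + h + h == 0) && ~~ sgn h) hs & coherent E N].

Lemma star_checkP n (ts : seq ('I_n.+2 * 'I_n.+2)) hs N (sgn := fun i : 'I_n.+2 => odd i) :
    ~~ odd n -> star_check sgn ts hs N ->
  let K := star_complex (ts ++ [seq (h, - h) | h <- hs]) in
  [/\ cyclic_triangulation K, equivelar (size N) K, orientable K,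
      forall u v, v - u \in N -> exists t, [/\ t \in K, u \in t & v \in t]
    & forall u v t, t \in K -> u \in t -> v \in t -> u != v -> v - u \in N].
Proof.
move=> en /and5P[h1 h2 h3 h4 /and4P[h5 h6 /allP h7 coh]] K.
have sgnD (i j : 'I_n.+2) : sgn (i + j) = sgn i (+) sgn j.
  rewrite /sgn -oddD [in RHS](divn_eq (i + j) n.+2) oddD oddM /= negbK (negPf en).
  by rewrite andbF.
have rotE := @star_rot _ _ sgnD ts hs.
have {}rotE x y : (x, y) \in star sgn ts hs -> flip (sgn x) (y - x, - x) \in star sgn ts hs /\
   flip (sgn y) (- y, x - y) \in star sgn ts hs.
  by apply: rotE => h /h7 /andP[/eqP-> /negPf].
have rotA x y : (x, y) \in star sgn ts hs ->
    adj (star sgn ts hs) (y - x) (- x) /\ adj (star sgn ts hs) (- y) (x - y).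
  by move/rotE; case: (sgn x); case: (sgn y) => -[e1 e2]; rewrite /adj e1 e2 ?orbT.
have lE : link_on (star sgn ts hs) N.
  by case: N h1 h2 h3 h4 h5 h6 {coh} => // x N h1 h2 h3 h4 _ _; apply: link_on_cycle; apply/and4P.
have [_ _ pE _] := lE.
rewrite /K -(star_complex_generators sgn); split.
- exact: star_cyclic lE h6 h5 rotA.
- exact: star_equivelar lE h6 rotA.
- exact: (@orientable_star _ _ _ h1 coh sgn sgnD rotE).
- move=> u v /(adjP lE h6)[y uv _]; exists [set u; u + (v - u); u + y].
  by rewrite (mem_star lE h6 rotA) uv !inE addrC subrK !eqxx orbT.
move=> u v t tK ut vt uv; have [y h _] := mem_star_vertex lE h6 rotA tK ut vt uv.
by case: (adj_mem pE h).
Qed.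

Lemma star_complex_eq n (E E' : seq ('I_n.+2 * 'I_n.+2)) :
  all (fun e => adj E' e.1 e.2) E && all (fun e => adj E e.1 e.2) E' ->
  star_complex E = star_complex E'.
Proof.
case/andP=> /allP s1 /allP s2; apply/eqP; rewrite eqEsubset.
by apply/andP; split; apply: star_complex_sub => x y; [move/s1 | move/s2].
Qed.

(** * Degree 7 *)

Definition adjacent n (K : complex n) (u v : 'I_n) := [exists t in K, (u \in t) && (v \in t)].

(** [ts] and [hs] restate the generators [l] with directions that are coherent when odd translations
    reverse, the orbit of {0, 4, 8} being the short one. *)
Lemma surface12 (l ts : seq (nat * nat)) (hs N : seq nat) (v := vmod 11) :
    let K := generated 11 [seq (0%N, p.1, p.2) | p <- l] in
    let ts' := [seq (v p.1, v p.2) | p <- ts] in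
    let hs' := map v hs in let N' := map v N in
    let E := ts' ++ [seq (h, - h) | h <- hs'] in
    let E' := [seq (v p.1, v p.2) | p <- l] in
    (all (fun e => adj E' e.1 e.2) E && all (fun e => adj E e.1 e.2) E') &&
      @star_check 10 (fun i => odd i) ts' hs' N' -> size N = 7%N ->
  [/\ cyclic_triangulation K, equivelar 7 K, orientable_genus K 2
    & forall i j, i != j -> adjacent K i j = (j - i \in N')].
Proof.
move=> K ts' hs' N' E E' /andP[/star_complex_eq EE' /star_checkP-/(_ isT)[cK qK oK a1 a2]] N7.
have KE : K = star_complex E by rewrite EE' /K generated_star.
move: qK; rewrite size_map N7 -KE in cK oK a1 a2 * => qK; split=> //.
  split=> //; rewrite /euler_char.
  have [_ sK _] := cK.
  (* 12 * 7 / 3 = 28 triangles and 28 * 3 / 2 = 42 edges: the Euler characteristic is 12 - 42 + 28 =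
     -2. *)
  have f3 := card_triangles sK qK; have e2 := card_edges sK.
  have -> : #|edges K| = 42%N by lia.
  by have -> : #|K| = 28%N by lia.
move=> i j ij; apply/existsP/idP.
  by case=> t /and3P[tK it jt]; apply: a2 tK it jt ij.
by case/a1=> t [tK it jt]; exists t; rewrite tK it jt.
Qed.

Lemma surfaceA : let A := generated 11 [:: (0, 1, 2); (0, 2, 6); (0, 4, 8)]%N in
  [/\ cyclic_triangulation A, equivelar 7 A, orientable_genus A 2
    & forall i j, i != j ->
      adjacent A i j = (j - i \in map (vmod 11) [:: 10; 11; 1; 2; 6; 8; 4]%N)].
Proof.
apply: (@surface12 [:: (1, 2); (2, 6); (4, 8)]%N [:: (1, 2); (2, 6)]%N [:: 8]%N
  [:: 10; 11; 1; 2; 6; 8; 4]%N) => //; by vm_compute.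
Qed.

Lemma surfaceB : let B := generated 11 [:: (0, 1, 5); (0, 1, 6); (0, 4, 8)]%N in
  [/\ cyclic_triangulation B, equivelar 7 B, orientable_genus B 2
    & forall i j, i != j ->
      adjacent B i j = (j - i \in map (vmod 11) [:: 7; 6; 1; 5; 11; 4; 8]%N)].
Proof.
apply: (@surface12 [:: (1, 5); (1, 6); (4, 8)]%N [:: (1, 5); (6, 1)]%N [:: 4]%N
  [:: 7; 6; 1; 5; 11; 4; 8]%N) => //; by vm_compute.
Qed.

Lemma adjacent_iso n m (K : complex n) (L : complex m) (f : 'I_n -> 'I_m) :
  injective f -> [set f @: (t : {set _}) | t in K] = L ->
  forall u v, adjacent K u v = adjacent L (f u) (f v).
Proof.
move=> fi <- u v; apply/existsP/existsP.
  by case=> t /and3P[tK ut vt]; exists (f @: t); rewrite !imset_f.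
case=> _ /and3P[/imsetP[t tK ->] /imsetP[u' ut /fi->] /imsetP[v' vt /fi->]].
by exists t; rewrite tK ut vt.
Qed.

(* Non-adjacent vertices of A have different parities, whereas
   0, 3, 6, 4, 2 is a closed walk of length 5 through non-adjacent vertices of B. *)
Lemma not_isomorphicAB :
  ~ isomorphic (generated 11 [:: (0, 1, 2); (0, 2, 6); (0, 4, 8)]%N)
               (generated 11 [:: (0, 1, 5); (0, 1, 6); (0, 4, 8)]%N).
Proof.
case=> f [fb fE]; have [g fg gf] := fb.
have [_ _ _ adjA] := surfaceA; have [_ _ _ adjB] := surfaceB.
have parity (i j : 'I_12) : i != j -> ~~ adjacent (generated 11 [:: (0, 1, 2); (0, 2, 6); (0, 4, 8)]%N) i j -> odd i != odd j.
  move=> ij; rewrite adjA // => h.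
  pose V := map (vmod 11) (iota 0 12).
  have VP (k : 'I_12) : k \in V.
    apply/mapP; exists (val k); first by rewrite mem_iota; exact: ltn_ord.
    by apply: val_inj; rewrite /= modn_small.
  have : all (fun i => all (fun j => (i != j) ==>
      (j - i \notin map (vmod 11) [:: 10; 11; 1; 2; 6; 8; 4]%N) ==> (odd i != odd j)) V) V.
    by vm_compute.
  by move/allP/(_ i (VP i))/allP/(_ j (VP j)); rewrite ij h.
have step (a b : nat) : vmod 11 a != vmod 11 b ->
    vmod 11 b - vmod 11 a \notin map (vmod 11) [:: 7; 6; 1; 5; 11; 4; 8]%N ->
    odd (g (vmod 11 a)) != odd (g (vmod 11 b)).
  move=> ab; rewrite -adjB // => h; apply: parity.
    by rewrite (inj_eq (can_inj gf)).
  by rewrite (adjacent_iso (can_inj fg) fE) !gf.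
have := step 0%N 3%N isT isT; have := step 3%N 6%N isT isT.
have := step 6%N 4%N isT isT; have := step 4%N 2%N isT isT; have := step 2%N 0%N isT isT.
by do 5!case: (odd (g _)).
Qed.

(** Orbits have one or three elements; discarding those with three keeps the cardinality prime to 3,
    so they cannot exhaust [A]. *)
Lemma fixpoint3 (T : finType) (A : {set T}) (f : T -> T) :
  (forall x, x \in A -> f x \in A) -> (forall x, f (f (f x)) = x) ->
  ~~ (3 %| #|A|)%N -> exists2 x, x \in A & f x = x.
Proof.
move=> fA f3; have [m] := ubnP #|A|; elim: m A fA => // m IH A fA le3 nd.
have [x xA] : exists x, x \in A.
  by apply/set0Pn; apply: contra nd => /eqP ->; rewrite cards0.
have [fx|nfx] := eqVneq (f x) x; first by exists x.
have nf2 : f (f x) != x by apply: contra nfx => /eqP e; rewrite -{2}(f3 x) e.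
have nf3 : f (f x) != f x by apply: contra nfx => /eqP e; rewrite -{2}(f3 x) !e.
pose B := A :\: [set x; f x; f (f x)].
have cB : (#|A| = #|B| + 3)%N.
  rewrite -(cardsID [set x; f x; f (f x)] A) addnC; congr (_ + _)%N.
  have /setIidPr -> : [set x; f x; f (f x)] \subset A.
    by apply/subsetP => y; rewrite !inE => /orP[/orP[]|] /eqP->; rewrite ?(fA _ xA) ?(fA _ (fA _ xA)).
  by apply/cards3; split; rewrite eq_sym.
have [|||y yB e] := IH B.
- move=> y; rewrite !inE !negb_or => /andP[/andP[/andP[y1 y2] y3] yA].
  rewrite fA // andbT; apply/andP; split; first (apply/andP; split).
  + by apply: contra y3 => /eqP e; rewrite -e !f3.
  + by apply: contra y1 => /eqP e; rewrite -(f3 y) e f3.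
  + by apply: contra y2 => /eqP e; rewrite -(f3 y) e f3.
- by move: le3; rewrite cB; lia.
- by move: nd; rewrite cB dvdn_addl.
by exists y => //; move: yB; rewrite inE => /andP[].
Qed.

Lemma fixpoint2 (T : finType) (A : {set T}) (f : T -> T) :
  (forall x, x \in A -> f x \in A) -> involutive f ->
  odd #|A| -> exists2 x, x \in A & f x = x.
Proof.
move=> fA f2; have [m] := ubnP #|A|; elim: m A fA => // m IH A fA le3 nd.
have [x xA] : exists x, x \in A.
  by apply/set0Pn; apply: contraTneq nd => ->; rewrite cards0.
have [fx|nfx] := eqVneq (f x) x; first by exists x.
pose B := A :\: [set x; f x].
have cB : (#|A| = #|B| + 2)%N.
  rewrite -(cardsID [set x; f x] A) addnC; congr (_ + _)%N.
  have /setIidPr -> : [set x; f x] \subset A.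
    by apply/subsetP => y; rewrite !inE => /orP[] /eqP->; rewrite ?(fA _ xA).
  by rewrite cards2 eq_sym nfx.
have [|||y yB e] := IH B.
- move=> y; rewrite !inE !negb_or => /andP[/andP[y1 y2] yA].
  rewrite fA // andbT; apply/andP; split.
  + by apply: contra y2 => /eqP e; rewrite -e f2.
  + by apply: contra y1 => /eqP e; rewrite -(f2 y) e f2.
- by move: le3; rewrite cB; lia.
- by move: nd; rewrite cB oddD addbF.
by exists y => //; move: yB; rewrite inE => /andP[].
Qed.

Section LinearCombination.
Variable R : comNzRingType.
Implicit Types x y a b c d k l : R.

(** Linear combination certificates: [k], [l], [m] are the coefficients with which the assumed
    equations add up to the goal, and [ring] checks the identity that remains. *)
Lemma lc1 k x y a b : a = b -> x - y = k * (a - b) -> x = y.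
Proof. by move=> -> e; apply: subr0_eq; rewrite e subrr mulr0. Qed.

Lemma lc2 k l x y a b c d : a = b -> c = d ->
  x - y = k * (a - b) + l * (c - d) -> x = y.
Proof. by move=> -> -> e; apply: subr0_eq; rewrite e !subrr !mulr0 addr0. Qed.

Lemma lc3 k l m x y a b c d (e f : R) : a = b -> c = d -> e = f ->
  x - y = k * (a - b) + l * (c - d) + m * (e - f) -> x = y.
Proof. by move=> -> -> -> E; apply: subr0_eq; rewrite E !subrr !mulr0 !addr0. Qed.

End LinearCombination.

Section Torsion.
Variable n : nat.
Implicit Types x y : 'I_n.+2.

Lemma torsion2 x y : x + x = 0 -> y + y = 0 -> x != 0 -> y != 0 -> x = y.
Proof.
have H (z : 'I_n.+2) : z + z = 0 -> z != 0 -> (z + z = n.+2)%N.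
  move=> /(congr1 (@nat_of_ord _))/= e /eqP z0.
  have zp : (0 < z)%N by rewrite lt0n; apply/eqP => z00; apply: z0; apply: val_inj.
  have lt := ltn_ord z; have := divn_eq (z + z) n.+2; rewrite e.
  have : ((z + z) %/ n.+2 < 2)%N by rewrite ltn_divLR //; lia.
  by case: (_ %/ _)%N => [|[|]] //; lia.
by move=> /H hx /H hy /hx e1 /hy e2; apply: val_inj; rewrite /=; lia.
Qed.

Lemma torsion3 x y : x + x + x = 0 -> y + y + y = 0 -> x != 0 -> y != 0 ->
  x = y \/ x = - y.
Proof.
have H (z : 'I_n.+2) : z + z + z = 0 -> z != 0 -> (z + z + z = n.+2 \/ z + z + z = 2 * n.+2)%N.
  move=> /(congr1 (@nat_of_ord _))/=; rewrite modnDml => e /eqP z0.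
  have zp : (0 < z)%N by rewrite lt0n; apply/eqP => z00; apply: z0; apply: val_inj.
  have lt := ltn_ord z; have := divn_eq (z + z + z) n.+2; rewrite e.
  have : ((z + z + z) %/ n.+2 < 3)%N by rewrite ltn_divLR //; lia.
  by case: (_ %/ _)%N => [|[|[|]]] //; lia.
move=> hx hy x0 y0; have := H x hx x0; have := H y hy y0.
have [e|ne] := eqVneq (x : nat) (y : nat); first by left; apply: val_inj.
move=> h1 h2; have hx1 := ltn_ord x; have hy1 := ltn_ord y.
right; apply: val_inj => /=; rewrite modn_small; lia.
Qed.

End Torsion.

Section Seven.
Variables (n : nat) (K : complex n.+2).
Hypotheses (sK : closed_surface K) (cK : forall t, t \in K -> @shift n.+2 @: t \in K).
Hypothesis K7 : equivelar 7 K.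

Definition link0 (x y : 'I_n.+2) := [set 0; x; y] \in K.
Local Notation T := link0.

(** Locked so that [inE] does not unfold membership in it. *)
Definition link_vertices := locked [set x | [exists y, T x y]].
Local Notation N := link_vertices.

Let K3 t : t \in K -> #|t| = 3%N. Proof. by case: sK => h _ _ _ _; apply: h. Qed.

Lemma translate_mem (i : 'I_n.+2) t : t \in K -> [set i + z | z in t] \in K.
Proof.
rewrite -(natr_Zp i); elim: (val i) => [|k IH] tK.
  by rewrite (eq_imset (g := id)) ?imset_id // => z; rewrite add0r.
have := cK (IH tK); rewrite -imset_comp.
by congr (_ \in K); apply: eq_imset => z /=; rewrite shiftE mulrSr addrAC.
Qed.

Lemma link0E (i x y : 'I_n.+2) : ([set i; i + x; i + y] \in K) = T x y.
Proof.
apply/idP/idP => h.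
  have := translate_mem (- i) h; rewrite set3_imset.
  by rewrite !addrA addNr !add0r.
by have := translate_mem i h; rewrite set3_imset addr0.
Qed.

Lemma link0C x y : T x y = T y x.
Proof. by rewrite /link0 set3_swap. Qed.

Lemma link0_neq x y : T x y -> [/\ x != 0, y != 0 & x != y].
Proof. by move/K3/cards3 => [x0 y0 xy]; rewrite eq_sym x0 eq_sym y0. Qed.

Lemma link0_rot x y : T x y -> T (y - x) (- x).
Proof.
by move/(translate_mem (- x)); rewrite set3_imset addr0 addNr [- x + y]addrC set3_rot.
Qed.

Lemma link_verticesP x : reflect (exists y, T x y) (x \in N).
Proof. by rewrite /link_vertices -lock inE; apply: existsP. Qed.

Lemma link_vertices_neq0 x : x \in N -> x != 0.
Proof. by case/link_verticesP=> y /link0_neq[]. Qed.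

Lemma link_vertices_edge x : x \in N -> [set 0; x] \in edges K.
Proof.
move=> xN; have x0 := link_vertices_neq0 xN; case/link_verticesP: xN => y xy.
rewrite inE cards2 (eq_sym 0) x0 /=; apply/existsP; exists [set 0; x; y].
by rewrite [_ \in K]xy /=; apply/subsetP => z; rewrite !inE => ->.
Qed.

Lemma card_link0 x : x \in N -> #|[set y | T x y]| = 2%N.
Proof.
move=> xN; have [_ _ K2 _ _] := sK; rewrite -(K2 _ (link_vertices_edge xN)).
rewrite -(card_in_imset (f := fun y => [set 0; x; y]) (D := mem [set y | T x y])); last first.
  move=> y z; rewrite !inE => xy xz e.
  case: (set3_inj (K3 xy) e) => -[] // xz' yx.
  by have [_ _] := link0_neq xz; rewrite xz' eqxx.
apply: eq_card => t; rewrite inE; apply/imsetP/andP.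
  case=> y; rewrite inE => xy ->; split=> //.
  by apply/subsetP => z; rewrite !inE => ->.
case=> tK /subsetP st; have x0 := link_vertices_neq0 xN.
have [|y tE] := set3_third (K3 tK) (st 0 (set21 _ _)) (st x (set22 _ _)); first by rewrite eq_sym.
by exists y; rewrite // inE /link0 -tE.
Qed.

Lemma link0_two x y1 y2 z : T x y1 -> T x y2 -> y1 != y2 -> T x z -> z = y1 \/ z = y2.
Proof.
move=> h1 h2 ne hz; have xN : x \in N by apply/link_verticesP; exists y1.
have /eqP/cards2P[a [b [ab e]]] := card_link0 xN.
have H y : T x y -> (y == a) || (y == b) by move=> h; rewrite -in_set2 -e inE.
move: (H _ h1) (H _ h2) (H _ hz) ne.
by do 3!case/orP=> /eqP->; rewrite ?eqxx //; auto.
Qed.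

Lemma link0_other x y : T x y -> exists2 z, T x z & z != y.
Proof.
move=> xy; have xN : x \in N by apply/link_verticesP; exists y.
have /eqP/cards2P[a [b [ab e]]] := card_link0 xN.
have Ta : T x a by have := set21 a b; rewrite -e inE.
have Tb : T x b by have := set22 a b; rewrite -e inE.
have [e1|n1] := eqVneq a y; last by exists a.
by exists b => //; rewrite -e1 eq_sym.
Qed.

(** Count pairs of a triangle at 0 and another vertex of it: two for each of the 7 triangles, and
    two for each link vertex. *)
Lemma card_link_vertices : #|N| = 7%N.
Proof.
have := double_counting [set~ 0] [set t in K | 0 \in t] (fun x t => x \in t).
rewrite [X in _ = X](eq_bigr (fun=> 2%N)); last first.
  move=> t; rewrite inE => /andP[tK t0].
  have := cardsD1 0 t; rewrite t0 (K3 tK) add1n => -[->].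
  by apply: eq_card => x; rewrite !inE.
rewrite sum_nat_const K7 (bigID (mem N)) /= [X in (_ + X)%N]big1 => [|x]; last first.
  rewrite !inE => /andP[x0 xN]; apply/eqP; rewrite cards_eq0; apply/eqP/setP => t.
  rewrite !inE; apply/negP => /andP[/andP[tK t0] tx].
  have [|y tE] := set3_third (K3 tK) t0 tx; first by rewrite eq_sym.
  by case/link_verticesP: xN; exists y; rewrite /link0 -tE.
rewrite (eq_bigr (fun=> 2%N)) => [|x /andP[_ xN]]; last first.
  have [_ _ K2 _ _] := sK; rewrite -(K2 _ (link_vertices_edge xN)).
  apply: eq_card => t; rewrite !inE -andbA; congr (_ && _).
  by rewrite subUset !sub1set.
rewrite addn0 sum_nat_const => /eqP; rewrite eqn_pmul2r // => /eqP <-.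
apply: eq_card => x; rewrite [RHS]unfold_in /= in_setC1.
by apply/idP/andP => [xN|[]//]; split=> //; apply: link_vertices_neq0.
Qed.

Lemma link_vertices_opp x : x \in N -> - x \in N.
Proof.
by case/link_verticesP=> y /link0_rot; rewrite link0C => h; apply/link_verticesP; exists (y - x).
Qed.

Lemma link0_mem x y : T x y -> x \in N /\ y \in N.
Proof.
by move=> h; split; apply/link_verticesP; [exists y | exists x; rewrite link0C].
Qed.

Lemma link_closed (S : {set 'I_n.+2}) x : x \in N -> x \in S ->
  (forall y z, y \in S -> T y z -> z \in S) -> N \subset S.
Proof.
move=> xN xS cS; apply/subsetP => y yN; have [_ _ _ con _] := sK.
have := con 0 x y (link_vertices_edge xN) (link_vertices_edge yN)
  (link_vertices_neq0 xN) (link_vertices_neq0 yN).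
case/connectP=> p; elim: p x xS {xN} => [|z p IH] x xS /=; first by move=> _ ->.
by case/andP=> xz; apply: IH; apply: cS xS xz.
Qed.

(** Each move along an edge adds a link vertex, so connectedness of the surface makes [N] generate
    the group. *)
Lemma multiples_all (S : {set 'I_n.+2}) : 0 \in S -> {subset N <= S} ->
  (forall x y, x \in S -> y \in S -> x + y \in S) -> forall v, v \in S.
Proof.
move=> S0 NS SD v; have [_ _ _ _ con] := sK.
case/connectP: (con 0 v) => p; elim: p 0 S0 => [|z p IH] x xS /=; first by move=> _ ->.
case/andP=> /existsP[t /and3P[tK xt zt]]; apply: IH.
have [<- //|xz] := eqVneq x z.
have [y tE] := set3_third (K3 tK) xt zt xz.
rewrite -[z](subrK x) addrC; apply: SD => //; apply: NS; apply/link_verticesP.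
by exists (y - x); rewrite -(link0E x) ![x + _]addrC !subrK -tE.
Qed.

Lemma short_triangle : exists2 h, h + h + h = 0 & T h (- h).
Proof.
pose W := [set p | T p.1 p.2].
have cW : #|W| = 14%N.
  have -> : #|W| = (\sum_(x in N) #|[set y | T x y]|)%N.
    rewrite -sum1_card (eq_bigl (fun p => (p.1 \in N) && T p.1 p.2)); last first.
      move=> [x y]; rewrite inE /=; apply/idP/andP => [h|[]//]; split=> //.
      by case: (link0_mem h).
    rewrite -(pair_big_dep (mem N) T (fun _ _ => 1%N)) /=.
    by apply: eq_bigr => x _; rewrite -sum1_card; apply: eq_bigl => y; rewrite inE.
  by rewrite (eq_bigr (fun=> 2%N)) ?sum_nat_const ?card_link_vertices // => x; apply: card_link0.
have [||| [x y]] := @fixpoint3 _ W (fun p => (p.2 - p.1, - p.1)).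
- by move=> [x y]; rewrite !inE /=; apply: link0_rot.
- by move=> [x y] /=; congr (_, _); ring.
- by rewrite cW.
rewrite inE /= => xy [e1 e2]; exists x; last by rewrite e2.
by move: e1; rewrite -e2 => e1; rewrite -{3}[x]opprK -{2}e1; ring.
Qed.

Lemma involution_vertex : exists2 m, m \in N & m + m = 0.
Proof.
have [||| m mN e] := @fixpoint2 _ N -%R.
- exact: link_vertices_opp.
- exact: opprK.
- by rewrite card_link_vertices.
by exists m; rewrite // -{1}e addNr.
Qed.

End Seven.

Section Classification.
Variables (n : nat) (K : complex n.+2).
Hypotheses (sK : closed_surface K) (cK : forall t, t \in K -> @shift n.+2 @: t \in K).
Hypothesis K7 : equivelar 7 K.
Local Notation T := (link0 K).
Local Notation N := (link_vertices K).
Let two := link0_two sK.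
Let rot := link0_rot cK.
Let neq := link0_neq sK.

(* Multiplication by b then identifies the complex on Z_12 generated by l with K. *)
Definition image_of (l : seq (nat * nat)) := exists b : 'I_n.+2,
  [/\ b *+ 12 = 0, b *+ 6 != 0, b *+ 4 != 0, forall z, z \in N -> exists k, z = b *+ k
    & forall p, p \in l -> T (b *+ p.1) (b *+ p.2)].

Lemma not_subset_small (s : seq 'I_n.+2) : (size s < 7)%N -> ~ (N \subset [set x in s]).
Proof.
move=> s7 /subset_leq_card; rewrite (card_link_vertices sK K7) leqNgt cardsE.
by rewrite (leq_ltn_trans (card_size s)).
Qed.

Lemma link_vertices_list (s : seq 'I_n.+2) : uniq s -> size s = 7%N ->
  {subset s <= N} -> forall z, z \in N -> z \in s.
Proof.
move=> us s7 sN z zN; suff /eqP e : [set x in s] == N by move: zN; rewrite -e inE.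
rewrite eqEcard (card_link_vertices sK K7) cardsE (card_uniqP us) s7 leqnn andbT.
by apply/subsetP => x; rewrite inE => /sN.
Qed.

Section Types.
Variables (h m : 'I_n.+2).
Hypotheses (h3 : h + h + h = 0) (hh : T h (- h)) (m2 : m + m = 0) (mN : m \in N).

Let h0 : h != 0. Proof. by case: (neq hh). Qed.
Let m0 : m != 0. Proof. exact: link_vertices_neq0 mN. Qed.
Let hN : h \in N. Proof. by case: (link0_mem hh). Qed.
Let hn : T (- h) h. Proof. by rewrite link0C. Qed.

Let hm : h != m.
Proof.
by apply: contraNneq h0 => e; apply/eqP; apply: (lc3 (k := 1) (l := -1) (m := -2) h3 m2 e); ring.
Qed.
Let nhm : - h != m.
Proof.
by apply: contraNneq h0 => e; apply/eqP; apply: (lc3 (k := 1) (l := 1) (m := 2) h3 m2 e); ring.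
Qed.
Let mE : - m = m. Proof. by apply: (lc1 (k := -1) m2); ring. Qed.

(* From b + b = m + h one gets 12 b = 0, m = 6 b and h = 8 b. *)
Lemma half_multiples b : b + b = m + h -> [/\ b *+ 12 = 0, m = b *+ 6 & h = b *+ 8].
Proof.
move=> e; split.
- by apply: (lc3 (k := 6) (l := 3) (m := 2) e m2 h3); ring.
- by apply: (lc3 (k := -3) (l := -1) (m := -1) e m2 h3); ring.
- by apply: (lc3 (k := -4) (l := -2) (m := -1) e m2 h3); ring.
Qed.

(** Take [c] itself as the multiplier, so that [m] is 6, [h] is 8 and [m + h] is 2 modulo 12. The
    three generators are then the edge {c, -c} rotated to {c, 2c}, the edge {m + h, m}, and {-h,
    h}. *)
Lemma typeA_end c : T c (- c) -> T m (m + h) -> c + c = m + h ->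
    (forall z, z \in N -> z \in [:: c; - c; h; - h; m; m + h; m - h]) ->
  image_of [:: (1, 2); (2, 6); (4, 8)]%N.
Proof.
move=> Tc Tm e cov; have [c12 m6 h8] := half_multiples e.
have c4 : c *+ 4 = - h by apply: (lc2 (k := 1) (l := 1) c12 h8); ring.
exists c; split=> //.
- by rewrite -m6.
- by rewrite c4 oppr_eq0.
- move=> z /cov; rewrite !inE.
  case/orP=> [/eqP->|]; first by exists 1%N.
  case/orP=> [/eqP->|]; first by exists 11%N; apply: (lc1 (k := -1) c12); ring.
  case/orP=> [/eqP->|]; first by exists 8%N.
  case/orP=> [/eqP->|]; first by exists 4%N.
  case/orP=> [/eqP->|]; first by exists 6%N.
  case/orP=> /eqP->; first by exists 2%N; rewrite mulr2n e.
  by exists 10%N; rewrite m6 h8; apply: (lc1 (k := -1) c12); ring.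
move=> p; rewrite !inE => /or3P[] /eqP -> /=.
- rewrite mulr1n mulr2n link0C; have := rot (etrans (link0C _ _ _) Tc).
  by rewrite !opprK.
- by rewrite mulr2n e -m6 link0C.
- by rewrite c4 -h8.
Qed.

(** Rotating the edge {h, m} yields the path [m - h], [- h], [h], [m], [m + h] in the 7-cycle. It is
    stable under negation, so the two vertices left are [b] and [- b], and they close the cycle. *)
Lemma typeA : T h m -> image_of [:: (1, 2); (2, 6); (4, 8)]%N.
Proof.
move=> Thm.
have Tmh : T m h by rewrite link0C.
have Tm : T m (m + h).
  by have := rot Tmh; rewrite link0C mE [h + m]addrC.
have Tnh : T (- h) (m - h) by rewrite link0C; apply: rot.
have ne_m : h != m + h.
  by apply: contraNneq m0 => e; apply/eqP; apply: (lc1 (k := -1) e); ring.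
have ne_nh : h != m - h.
  by apply: contraNneq nhm => e; apply/eqP; apply: (lc2 (k := -1) (l := 1) h3 e); ring.
pose P := [:: h; - h; m; m + h; m - h].
have PN : {subset P <= N}.
  move=> z; rewrite !inE => /orP[/eqP->|/orP[/eqP->|/orP[/eqP->|/orP[]/eqP->]]].
  - exact: hN.
  - exact: link_vertices_opp hN.
  - exact: mN.
  - by case: (link0_mem Tm).
  - by case: (link0_mem Tnh).
have nPh z : z != h -> z != - h -> z != m -> z != m + h -> z != m - h -> z \notin P.
  by rewrite !inE !negb_or => -> -> -> -> ->.
have uP : uniq P.
  rewrite /= !inE !negb_or hm nhm ne_m ne_nh andbT /=.
  have [_ _ ->] := neq hh => /=; do ![apply/andP; split] => //.
  - by apply: contraNneq hm => e; apply/eqP; apply: (lc2 (k := 1) (l := 1) h3 e); ring.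
  - by apply: contraNneq m0 => e; apply/eqP; apply: (lc1 (k := -1) e); ring.
  - by apply: contraNneq h0 => e; apply/eqP; apply: (lc1 (k := -1) e); ring.
  - by apply: contraNneq h0 => e; apply/eqP; apply: (lc1 (k := 1) e); ring.
  - by apply: contraNneq h0 => e; apply/eqP; apply: (lc2 (k := 1) (l := -1) h3 e); ring.
have [b bN bP] : exists2 b, b \in N & b \notin P.
  have /subsetPn[b bN] : ~~ (N \subset [set x in P]) by apply/negP; apply: not_subset_small.
  by rewrite inE; exists b.
have PNeg z : - z \in P -> z \in P.
  rewrite !inE ![- z == _]eqr_oppLR opprK opprB opprD mE [h + m]addrC.
  by do ![case/orP]; move=> ->; rewrite ?orbT.
have nbP : - b \notin P by apply: contra bP; apply: PNeg.
have nbN : - b \in N by apply: link_vertices_opp.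
have bnb : b != - b.
  apply: contraNneq bP => e.
  have -> : b = m; last by rewrite !inE eqxx !orbT.
  apply: torsion2 => //; first by apply: (lc1 (k := 1) e); ring.
  exact: link_vertices_neq0 bN.
have cov z : z \in N -> z \in [:: b, - b & P].
  apply: link_vertices_list => //; last first.
    by move=> y; rewrite !in_cons => /orP[/eqP->|/orP[/eqP->|/PN]].
  rewrite -[uniq _]/((b \notin - b :: P) && ((- b \notin P) && uniq P)).
  by rewrite in_cons negb_or bnb bP nbP uP.
have Th z : T h z -> z \in P.
  by move/(two hh Thm nhm)=> [] ->; rewrite !inE eqxx ?orbT.
have Tm' z : T m z -> z \in P.
  by move/(two Tmh Tm ne_m)=> [] ->; rewrite !inE eqxx ?orbT.
have Tnh' z : T (- h) z -> z \in P.
  by move/(two hn Tnh ne_nh)=> [] ->; rewrite !inE eqxx ?orbT.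
have nbr c z : c \notin P -> T c z -> z \in P -> z = m + h \/ z = m - h.
  move=> cP Tcz; rewrite !inE => /orP[/eqP zE|/orP[/eqP zE|/orP[/eqP zE|/orP[]/eqP zE]]]; auto.
  - by case/negP: cP; apply: Th; rewrite link0C -zE.
  - by case/negP: cP; apply: Tnh'; rewrite link0C -zE.
  - by case/negP: cP; apply: Tm'; rewrite link0C -zE.
have nb z : T b z -> [\/ z = m + h, z = m - h | z = - b].
  move=> Tbz; have [_ zN] := link0_mem Tbz; move: (cov z zN); rewrite !in_cons.
  case/orP=> [/eqP zb|/orP[/eqP->|zP]]; first by have [_ _] := neq Tbz; rewrite zb eqxx.
    by constructor 3.
  by case: (nbr _ _ bP Tbz zP) => ->; [constructor 1 | constructor 2].
have nnb z : T (- b) z -> [\/ z = m + h, z = m - h | z = b].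
  move=> Tbz; have [_ zN] := link0_mem Tbz; move: (cov z zN); rewrite !in_cons.
  case/orP=> [/eqP->|/orP[/eqP zb|zP]]; first by constructor 3.
    by have [_ _] := neq Tbz; rewrite zb eqxx.
  by case: (nbr _ _ nbP Tbz zP) => ->; [constructor 1 | constructor 2].
(* Otherwise both neighbours of [b] are ends of the path, which closes a 6-cycle that misses
   [- b]. *)
have Tb : T b (- b).
  case/link_verticesP: (bN) => y1 Tb1; have [y2 Tb2 y21] := link0_other sK Tb1.
  have [e1|n1] := eqVneq y1 (- b); first by rewrite -e1.
  have [e2|n2] := eqVneq y2 (- b); first by rewrite -e2.
  have [Tp Tq] : T b (m + h) /\ T b (m - h).
    case: (nb _ Tb1) => [e1|e1|e1]; case: (nb _ Tb2) => [e2|e2|e2];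
      by move: y21 n1 n2 Tb1 Tb2; rewrite e1 e2 ?eqxx.
  have pq : m + h != m - h.
    by apply: contraNneq h0 => e; apply/eqP; apply: (lc2 (k := 1) (l := -1) h3 e); ring.
  have /subsetP/(_ _ nbN) : N \subset [set x in b :: P].
    apply: (link_closed sK bN); first by rewrite inE mem_head.
    move=> y z; rewrite !in_set => + Tyz.
    have PS x : x \in P -> x \in b :: P by move=> xP; rewrite in_cons xP orbT.
    rewrite in_cons => /orP[/eqP yE|yP].
      by move: Tyz; rewrite yE => /(two Tp Tq pq)[] ->; apply: PS; rewrite !inE eqxx !orbT.
    have mP : m \in P by rewrite !inE eqxx !orbT.
    have nhP : - h \in P by rewrite !inE eqxx !orbT.
    have bx x : x \in P -> x != b by move=> xP; apply: contraNneq bP => <-.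
    move: yP; rewrite [_ \in P]inE !in_cons in_nil orbF => yP; move: yP Tyz.
    case/orP=> [/eqP->|/orP[/eqP->|/orP[/eqP->|/orP[]/eqP->]]].
    - by move/Th => zP; apply: PS.
    - by move/Tnh' => zP; apply: PS.
    - by move/Tm' => zP; apply: PS.
    - move/(two (etrans (link0C _ _ _) Tm) (etrans (link0C _ _ _) Tp) (bx _ mP)) => [] ->.
        exact: PS.
      by rewrite ?in_cons eqxx.
    - move/(two (etrans (link0C _ _ _) Tnh) (etrans (link0C _ _ _) Tq) (bx _ nhP)) => [] ->.
        exact: PS.
      by rewrite ?in_cons eqxx.
  by rewrite inE in_cons eq_sym (negPf bnb) (negPf nbP).
have Tnb : T (- b) b by rewrite link0C.
have b0 : b != 0 by apply: link_vertices_neq0 bN.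
(* The edge {b, -b} rotates to one from [- b] to [- b - b]; that must be an end of the path, since
   [- b - b = b] would make [b] one of [h], [- h]. *)
have := rot Tb; rewrite link0C => /nnb[] e.
- apply: (@typeA_end (- b)) => //; first by rewrite opprK.
  move=> z /cov; rewrite !in_cons opprK orbCA; exact.
- apply: (@typeA_end b) => //.
  by apply: (lc2 (k := -1) (l := -1) e m2); ring.
- case/negP: bP; have b3 : b + b + b = 0 by apply: (lc1 (k := -1) e); ring.
  by case: (torsion3 b3 h3 b0 h0) => ->; rewrite !inE eqxx ?orbT.
Qed.

(** The multiplier is [x *+ 7], equal to [h - x] and to [x + m]. It turns [h - x], [- x], [m], [x]
    into 1, 5, 6, 7; the pairs 1, 5 and 1, 6 are rotations of the edges {x, h} and {m, x}. *)
Lemma typeB x : T h x -> T m x -> x + x = m + h ->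
    (forall z, z \in N -> z \in [:: h; - h; x; x - h; - x; h - x; m]) ->
  image_of [:: (1, 5); (1, 6); (4, 8)]%N.
Proof.
move=> Thx Tmx e cov; have [x12 m6 h8] := half_multiples e.
have b4 : x *+ 7 *+ 4 = - h by apply: (lc2 (k := 3) (l := 1) x12 h8); ring.
have b6 : x *+ 7 *+ 6 = m by apply: (lc2 (k := 3) (l := -1) x12 m6); ring.
have b8 : x *+ 7 *+ 8 = h by apply: (lc2 (k := 4) (l := -1) x12 h8); ring.
have b1 : x *+ 7 = h - x by apply: (lc1 (k := -1) h8); ring.
have b5 : x *+ 7 *+ 5 = - x by apply: (lc1 (k := 3) x12); ring.
exists (x *+ 7); split.
- by apply: (lc1 (k := 7) x12); ring.
- by rewrite b6.
- by rewrite b4 oppr_eq0.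
- move=> z /cov; rewrite !inE.
  case/orP=> [/eqP->|]; first by exists 8%N; rewrite b8.
  case/orP=> [/eqP->|]; first by exists 4%N; rewrite b4.
  case/orP=> [/eqP->|]; first by exists 7%N; apply: (lc1 (k := -4) x12); ring.
  case/orP=> [/eqP->|]; first by exists 11%N; rewrite h8; apply: (lc1 (k := -7) x12); ring.
  case/orP=> [/eqP->|]; first by exists 5%N; rewrite b5.
  case/orP=> /eqP->; first by exists 1%N; rewrite mulr1n b1.
  by exists 6%N; rewrite b6.
move=> p; rewrite !inE => /or3P[] /eqP -> /=.
- by rewrite mulr1n b5 b1; apply: rot; rewrite link0C.
- rewrite mulr1n b6; have := rot Tmx; rewrite mE.
  suff -> : x *+ 7 = x + m by [].
  by rewrite m6; ring.
- by rewrite b4 b8.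
Qed.

(** If [x + x = m], the edge {x, m} rotates to {x, -x}, a third edge at [x] besides those to [h] and
    [m]. *)
Lemma no_typeC x : T h x -> T m x -> x + x = m -> x != m -> x != - h -> False.
Proof.
move=> Thx Tmx e xm xnh; have Txm : T x m by rewrite link0C.
have := rot Txm; rewrite link0C.
have -> : m - x = x by apply: (lc1 (k := -1) e); ring.
rewrite link0C => Txn.
have [e1|e1] := two (etrans (link0C _ _ _) Thx) Txm hm Txn.
  by rewrite -e1 opprK eqxx in xnh.
by rewrite -mE -e1 opprK eqxx in xm.
Qed.

End Types.

Lemma short_opp (h : 'I_n.+2) : h + h + h = 0 -> T h (- h) ->
  (- h) + (- h) + (- h) = 0 /\ T (- h) (- - h).
Proof.
by move=> h3 hh; split; [rewrite -!opprD h3 oppr0 | rewrite opprK link0C].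
Qed.

Lemma classification : image_of [:: (1, 2); (2, 6); (4, 8)]%N \/
  image_of [:: (1, 5); (1, 6); (4, 8)]%N.
Proof.
have [h h3 hh] := short_triangle sK cK K7.
have [m mN m2] := involution_vertex sK cK K7.
have [nh3 nhh] := short_opp h3 hh.
have m0 := link_vertices_neq0 sK mN.
have [h0 _ hnh] := neq hh.
have mE : - m = m by apply: (lc1 (k := -1) m2); ring.
have hm : h != m.
  by apply: contraNneq h0 => e; apply/eqP; apply: (lc3 (k := 1) (l := -1) (m := -2) h3 m2 e); ring.
have nhm : - h != m by rewrite eqr_oppLR mE.
have [x Thx xnh] := link0_other sK hh.
have [_ x0 hx] := neq Thx.
have hn : T (- h) h by rewrite link0C.
have Txh : T x h by rewrite link0C.
have Tnh : T (- h) (x - h) by rewrite link0C; apply: rot.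
have Tnx : T (- x) (h - x) by rewrite link0C; apply: rot.
have [_ xh0 _] := neq Tnh.
have [xm|xm] := eqVneq x m; first by left; apply: (typeA h3 hh m2 mN); rewrite -xm.
have [xhm|xhm] := eqVneq (x - h) m.
  by left; apply: (typeA nh3 nhh m2 mN); rewrite -xhm.
have hxh : h != x - h.
  by apply: contraNneq xnh => e; apply/eqP; apply: (lc2 (k := 1) (l := -1) h3 e); ring.
have nh_x : - h != x by rewrite eq_sym.
have xx : x + x != 0 by apply: contraNneq xm => e; rewrite (torsion2 e m2).
have x_nx : x != - x by rewrite -subr_eq0 opprK.
(* Equality would close the link early, as the 4-cycle [h], [- h], [- x], [x]. *)
have xh_nx : x - h != - x.
  apply/eqP => e; have Tnxx : T (- x) x.
    by have := Tnx; have -> : h - x = x by apply: (lc1 (k := -1) e); ring.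
  have h_nx : h != - x by rewrite -eqr_oppLR eq_sym.
  have Tnhx : T (- h) (- x) by rewrite -e.
  apply: (@not_subset_small [:: h; - h; x; - x]) => //.
  have hN : h \in N by case: (link0_mem hh).
  apply: (link_closed sK hN) => [|y z]; first by rewrite !inE eqxx.
  rewrite !inE => /orP[/eqP->|/orP[/eqP->|/orP[]/eqP->]].
  - by move/(two hh Thx nh_x)=> [] ->; rewrite eqxx ?orbT.
  - by move/(two hn Tnhx h_nx)=> [] ->; rewrite eqxx ?orbT.
  - by move/(two Txh (etrans (link0C _ _ _) Tnxx) h_nx)=> [] ->; rewrite eqxx ?orbT.
  - by move/(two Tnxx (etrans (link0C _ _ _) Tnhx) xnh)=> [] ->;
      rewrite eqxx ?orbT.
have xh_hx : x - h != h - x.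
  apply/eqP => e; have e2 : (x - h) + (x - h) = 0 by apply: (lc1 (k := 1) e); ring.
  by case/negP: xhm; rewrite (torsion2 e2 m2).
have cov : forall z, z \in N -> z \in [:: h; - h; x; x - h; - x; h - x; m].
  apply: link_vertices_list => //; last first.
    move=> z; rewrite !in_cons in_nil orbF.
    have [hN nhN] := link0_mem hh; have [_ xN] := link0_mem Thx.
    have [_ xhN] := link0_mem Tnh; have [nxN hxN] := link0_mem Tnx.
    by do 6!case/orP=> [/eqP-> //|]; move/eqP->.
  rewrite /= !inE !negb_or hnh hx hxh hm nhm x_nx xm xh_nx xh_hx xhm /= !andbT.
  have c1 : h != - x by rewrite -eqr_oppLR eq_sym.
  have c2 : h != h - x by apply: contraNneq x0 => e; apply/eqP; apply: (lc1 (k := 1) e); ring.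
  have c4 : - h != x - h by apply: contraNneq x0 => e; apply/eqP; apply: (lc1 (k := -1) e); ring.
  have c5 : - h != - x by rewrite eqr_opp.
  have c6 : - h != h - x.
    by apply: contraNneq xnh => e; apply/eqP; apply: (lc2 (k := 1) (l := 1) h3 e); ring.
  have c7 : x != x - h by apply: contraNneq h0 => e; apply/eqP; apply: (lc1 (k := 1) e); ring.
  have c8 : x != h - x.
    by apply: contraNneq xh_nx => e; apply/eqP; apply: (lc1 (k := 1) e); ring.
  have c9 : - x != h - x by apply: contraNneq h0 => e; apply/eqP; apply: (lc1 (k := -1) e); ring.
  have c10 : - x != m by rewrite eqr_oppLR mE.
  have c11 : h - x != m by rewrite -opprB eqr_oppLR mE.
  by rewrite c1 c2 nh_x c4 c5 c6 c7 c8 c9 c10 c11.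
(* The pair [- h], [x - h] reads the path [x - h], [- h], [h], [x] from its other end, so [typeB]
   and [no_typeC] apply to it as well. *)
have cov' : forall z, z \in N ->
    z \in [:: - h; - - h; x - h; x - h - - h; - (x - h); - h - (x - h); m].
  move=> z /cov; rewrite !inE opprK subrK opprB.
  have -> : - h + (h - x) = - x by ring.
  by do ![case/orP]; move=> ->; rewrite ?orbT.
have Tm y : T m y -> [\/ y = x, y = x - h, y = - x | y = h - x].
  move=> Tmy; have Tym : T y m by rewrite link0C.
  have [_ yN] := link0_mem Tmy; have [_ _ my] := neq Tmy; move: (cov y yN); rewrite !in_cons in_nil orbF.
  case/orP=> [/eqP yE|].
    rewrite yE in Tym; have [e|e] := two hh Thx nh_x Tym.
      by rewrite e eqxx in nhm.
    by rewrite e eqxx in xm.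
  case/orP=> [/eqP yE|].
    rewrite yE in Tym; have [e|e] := two hn Tnh hxh Tym.
      by rewrite e eqxx in hm.
    by rewrite e eqxx in xhm.
  case/orP=> [/eqP|]; first by constructor 1.
  case/orP=> [/eqP|]; first by constructor 2.
  case/orP=> [/eqP|]; first by constructor 3.
  case/orP=> [/eqP|/eqP e]; first by constructor 4.
  by rewrite e eqxx in my.
have [u Tmu] : exists u, T m u by case/link_verticesP: mN => u; exists u.
(* Rotating {m, u} shows that the two neighbours of [m] differ by [m]. *)
have Tmum : T m (u + m) by have := rot Tmu; rewrite mE link0C.
have nm0 : ~ m = 0 by apply/eqP.
have nhm' : ~ h = m by apply/eqP.
have nnhm' : ~ - h = m by apply/eqP.
have endB : T m x -> x + x = m + h -> image_of [:: (1, 5); (1, 6); (4, 8)]%N.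
  by move=> Tmx e; apply: (typeB h3 hh m2 mN Thx Tmx e cov).
have endB' : T m (x - h) -> x + x = m + h -> image_of [:: (1, 5); (1, 6); (4, 8)]%N.
  move=> Tmx e; apply: (typeB nh3 nhh m2 mN Tnh Tmx _ cov').
  by apply: (lc1 (k := 1) e); ring.
have noC : T m x -> x + x = m -> False.
  by move=> Tmx e; apply: (no_typeC h3 hh m2 Thx Tmx e xm xnh).
have noC' : T m (x - h) -> (x - h) + (x - h) = m -> False.
  move=> Tmx e; apply: (no_typeC nh3 nhh m2 Tnh Tmx e xhm).
  by rewrite opprK eq_sym.
(* Of the 16 choices for [u] and [u + m], equal ones force [m = 0], those differing by [h] force [m]
   to be [h] or [- h], and opposite ones are excluded by [no_typeC]. The others pair [x] with
   [h - x], or [x - h] with [- x]; both mean [x + x = m + h]. *)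
right; case: (Tm u Tmu) => uE; case: (Tm _ Tmum) => vE; move: Tmu Tmum; rewrite vE uE => Tu Tv;
  move: vE; rewrite uE => e.
- by case: nm0; apply: (lc1 (k := 1) e); ring.
- by case: nnhm'; apply: (lc1 (k := -1) e); ring.
- by case: (noC Tu); apply: (lc2 (k := 1) (l := -1) e m2); ring.
- by apply: endB => //; apply: (lc2 (k := 1) (l := -1) e m2); ring.
- by case: nhm'; apply: (lc1 (k := -1) e); ring.
- by case: nm0; apply: (lc1 (k := 1) e); ring.
- by apply: endB' => //; apply: (lc2 (k := 1) (l := -1) e m2); ring.
- by case: (noC' Tu); apply: (lc2 (k := 1) (l := -1) e m2); ring.
- by case: (noC Tv); apply: (lc1 (k := -1) e); ring.
- by apply: endB' => //; apply: (lc1 (k := -1) e); ring.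
- by case: nm0; apply: (lc1 (k := 1) e); ring.
- by case: nhm'; apply: (lc1 (k := -1) e); ring.
- by apply: endB => //; apply: (lc1 (k := -1) e); ring.
- by case: (noC' Tv); apply: (lc1 (k := -1) e); ring.
- by case: nnhm'; apply: (lc1 (k := -1) e); ring.
- by case: nm0; apply: (lc1 (k := 1) e); ring.
Qed.

End Classification.

Lemma isomorphic_sym n m (K : complex n) (L : complex m) :
  isomorphic K L -> isomorphic L K.
Proof.
case=> f [[g fg gf] <-]; exists g; split; first by exists f.
rewrite -imset_comp (eq_imset (g := id)) ?imset_id // => t /=.
by rewrite -imset_comp (eq_imset (g := id)) ?imset_id.
Qed.

(** Multiplication by [b] is injective on Z_12 since [b] has order exactly 12, and onto since its
    multiples contain [N], which generates the group. It carries triangles to triangles, and equal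
    degrees leave no triangle of [K] uncovered. *)
Lemma image_of_isomorphic n (K : complex n.+2) (l : seq (nat * nat)) :
    let L := generated 11 [seq (0%N, p.1, p.2) | p <- l] in
    closed_surface K -> (forall t, t \in K -> @shift n.+2 @: t \in K) -> equivelar 7 K ->
    equivelar 7 L -> image_of K l ->
  n.+2 = 12%N /\ isomorphic K L.
Proof.
move=> L sK cK K7 L7 [b [b12 b6 b4 bN bl]].
pose f (i : 'I_12) := b *+ i.
have bmod k : b *+ (k %% 12) = b *+ k.
  by rewrite [in RHS](divn_eq k 12) mulrnDr mulnC mulrnA b12 mul0rn add0r.
(* Every nonzero [d] modulo 12 has a multiple congruent to 4 or 6, as a finite check shows. *)
have bd d : (0 < d < 12)%N -> b *+ d != 0.
  move=> d12; have /allP/(_ d) : all (fun d => has (fun k => (d * k %% 12 \in [:: 4; 6])%N) (iota 0 12)) (iota 1 11) by [].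
  rewrite mem_iota => /(_ d12)/hasP[k _]; rewrite !inE => dk.
  apply/negP => /eqP e; have e2 : b *+ (d * k %% 12) = 0 by rewrite bmod mulrnA e mul0rn.
  by case/orP: dk e2 => /eqP -> /eqP; apply/negP.
have f_lt (i j : 'I_12) : (i < j)%N -> f i != f j.
  move=> ij; rewrite eq_sym -subr_eq0 /f -mulrnBr 1?ltnW // bd //.
  by rewrite subn_gt0 ij (leq_ltn_trans (leq_subr _ _)).
have f_inj : injective f.
  move=> i j e; apply: val_inj => /=.
  by case: (ltngtP i j) => // /f_lt; rewrite e eqxx.
have f_surj v : v \in [set f i | i in 'I_12].
  have bS k : b *+ k \in [set f i | i in 'I_12].
    by apply/imsetP; exists (Ordinal (ltn_pmod k (isT : 0 < 12)%N)); rewrite // /f /= bmod.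
  apply: (multiples_all sK cK) => [|z /bN[k ->]//|x y].
    by rewrite -(mulr0n b).
  by case/imsetP=> i _ ->; case/imsetP=> j _ ->; rewrite /f -mulrnDr.
have f_bij : bijective f.
  apply: (inj_card_bij f_inj); rewrite -(card_imset 'I_12 f_inj); apply/subset_leq_card/subsetP.
  by move=> v _; apply: f_surj.
split; first by have := bij_eq_card f_bij; rewrite !card_ord.
apply: isomorphic_sym; exists f; split=> //.
have fvD i a : f (i + vmod 11 a) = f i + b *+ a.
  by rewrite /f /= bmod mulrnDr bmod.
have LK t : t \in L -> f @: t \in K.
  rewrite /L generated_star => /star_complexP[i [x [y [/mapP[p pl [-> ->]] ->]]]].
  rewrite set3_imset !fvD link0E //; exact: bl.
apply/eqP; rewrite eqEsubset; apply/andP; split.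
  by apply/subsetP => _ /imsetP[t tL ->]; apply: LK.
apply/subsetP => t tK; have [K3 _ _ _ _] := sK.
have [v vt] : exists v, v \in t by apply/set0Pn; rewrite -card_gt0 K3.
have /imsetP[w _ vw] := f_surj v.
(* The images of the 7 triangles at [w] are 7 triangles at [v], hence all of them. *)
pose S := [set f @: (s : {set _}) | s in [set s in L | w \in s]].
have SE : S == [set t in K | v \in t].
  rewrite eqEcard K7 card_imset; last exact: imset_inj.
  rewrite L7 leqnn andbT; apply/subsetP => _ /imsetP[s + ->].
  by rewrite inE => /andP[sL ws]; rewrite inE LK //= vw imset_f.
have : t \in S by rewrite (eqP SE) inE tK.
by case/imsetP=> s; rewrite inE => /andP[sL _] ->; apply: imset_f.
Qed.

Local Close Scope ring_scope.

Theorem mainTheorem1 :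
  (forall q : nat,
      (exists2 k, 2 <= k & q = 3 * k) \/ (exists2 k, 3 <= k & q = 3 * k + 1) ->
      (exists (nf : nat -> nat) (Kf : forall i, complex (nf i)),
          (forall i, [/\ cyclic_triangulation (Kf i), equivelar q (Kf i)
                       & orientable (Kf i)]) /\
          (forall i j, i <> j -> ~ isomorphic (Kf i) (Kf j))) /\
      (exists (nf : nat -> nat) (Kf : forall i, complex (nf i)),
          (forall i, [/\ cyclic_triangulation (Kf i), equivelar q (Kf i)
                       & ~ orientable (Kf i)]) /\
          (forall i j, i <> j -> ~ isomorphic (Kf i) (Kf j)))) /\
  (let A := generated 11 [:: (0, 1, 2); (0, 2, 6); (0, 4, 8)] in
   let B := generated 11 [:: (0, 1, 5); (0, 1, 6); (0, 4, 8)] in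
   [/\ cyclic_triangulation A /\ equivelar 7 A /\ orientable_genus A 2,
       cyclic_triangulation B /\ equivelar 7 B /\ orientable_genus B 2,
       ~ isomorphic A B &
       forall (n : nat) (K : complex n),
         cyclic_triangulation K -> equivelar 7 K ->
         n = 12 /\ (isomorphic K A \/ isomorphic K B)]).
Proof.
split.
  move=> q Hq; split.
    apply: orientable_family; move: q Hq.
    by apply: mod12_ind orientable_data12 _ _ _ _ _ _ _ _; [exact: orientable_6 | exact: orientable_9 | exact: orientable_12 | exact: orientable_15 | exact: orientable_10 | exact: orientable_13 | exact: orientable_16 | exact: orientable_19].
  apply: nonorientable_family; move: q Hq.
  by apply: mod12_ind nonorientable_data12 _ _ _ _ _ _ _ _; [exact: nonorientable_6 | exact: nonorientable_9 | exact: nonorientable_12 | exact: nonorientable_15 | exact: nonorientable_10 | exact: nonorientable_13 | exact: nonorientable_16 | exact: nonorientable_19].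
move=> A B.
have [cA qA oA _] := surfaceA; have [cB qB oB _] := surfaceB.
split=> //; first exact: not_isomorphicAB.
move=> [|[|n]] K [// n3 sK cK] K7.
case: (classification sK cK K7) => iK.
  by have [e ?] := @image_of_isomorphic n K [:: (1, 2); (2, 6); (4, 8)] sK cK K7 qA iK; split=> //; left.
by have [e ?] := @image_of_isomorphic n K [:: (1, 5); (1, 6); (4, 8)] sK cK K7 qB iK; split=> //; right.
Qed.
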